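(* One has $$\mathcal{R}(2,1)+\mathcal{C}(2,1)\ \subset\ \mathcal{B}(D,\ell_2)^K\ \subset\ \mathcal{M}_{S_1}(2,1),$$ with quantitative bounds, and the second inclusion is strict. Moreover, neither the row condition ($A\in\mathcal{R}(2,1)$) nor the column condition ($A\in\mathcal{C}(2,1)$) is necessary for membership in $\mathcal{B}(D,\ell_2)^K$: the sets $\mathcal{B}(D,\ell_2)^K\setminus\mathcal{R}(2,1)$ and $\mathcal{B}(D,\ell_2)^K\setminus\mathcal{C}(2,1)$ are both nonempty.
   Context: All matrices are infinite complex matrices $A=(a_{j,m})_{j,m\ge1}$, assumed upper triangular: $a_{j,m}=0$ for $m<j$. For $k\ge0$ the $k$-th diagonal $A_k$ is the matrix agreeing with $A$ on the entries $(l,l+k)$, $l\ge1$, and vanishing elsewhere; write $a_k^{\,l}:=a_{l,l+k}$. $\|\cdot\|_{B(\ell_2)}$ is the operator norm on $\ell_2$ and $S_1$ is the trace class; thus $\|A_k\|_{S_1}=\sum_l|a_k^{\,l}|$ and $\|A_k\|_{B(\ell_2)}=\sup_l|a_k^{\,l}|$. Dyadic blocks: $I_0=\{0,1\}$ and $I_n=\{k\in\mathbb{N}:2^n\le k<2^{n+1}\}$ for $n\ge1$. For a scalar sequence $x=(x_k)_{k\ge0}$, $\|x\|_{\ell(2,1)}=\sum_{n\ge0}\bigl(\sum_{k\in I_n}|x_k|^2\bigr)^{1/2}$. Put $\|A\|_{\mathcal{M}_{S_1}(2,1)}=\bigl\|(\|A_k\|_{S_1})_{k\ge0}\bigr\|_{\ell(2,1)}$.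 Row and column sequences: $R_j(A)=(a_k^{\,j})_{k\ge0}$ for $j\ge1$, and $C_m(A)=(a_k^{\,m-k})_{0\le k\le m-1}$ for $m\ge1$, extended by zero. Put $\|A\|_{\mathcal{R}(2,1)}=\sum_{j\ge1}\|R_j(A)\|_{\ell(2,1)}$ and $\|A\|_{\mathcal{C}(2,1)}=\sum_{m\ge1}\|C_m(A)\|_{\ell(2,1)}$. The spaces $\mathcal{M}_{S_1}(2,1)$, $\mathcal{R}(2,1)$, $\mathcal{C}(2,1)$ consist of the upper triangular matrices for which the respective quantity is finite, and $\mathcal{R}(2,1)+\mathcal{C}(2,1)=\{A'+A'':A'\in\mathcal{R}(2,1),\ A''\in\mathcal{C}(2,1)\}$. Matricial Bloch space: for $0\le r<1$ let $A'(r)=\sum_{k\ge1}kA_kr^{k-1}$, understood entrywise and required to define a bounded operator on $\ell_2$ for each $r$. $\mathcal{B}(D,\ell_2)$ is the space of upper triangular $A$ with $\|A\|_{\mathcal{B}(D,\ell_2)}:=\sup_{0\le r<1}(1-r^2)\|A'(r)\|_{B(\ell_2)}+\|A_0\|_{B(\ell_2)}<\infty$. Köthe dual: $\mathcal{B}(D,\ell_2)^K$ is the set of upper triangular $A$ such that $\sum_{j,m}|a_{j,m}b_{j,m}|<\infty$ for every $B=(b_{j,m})\in\mathcal{B}(D,\ell_2)$. *)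

(* Defs.v *)
From HB Require Import structures.
From mathcomp Require Import all_boot all_order all_algebra.
From mathcomp Require Import all_classical all_reals all_analysis.
From mathcomp Require Import complex.

Set Implicit Arguments.
Unset Strict Implicit.
Unset Printing Implicit Defensive.

Import Order.TTheory GRing.Theory Num.Theory.
Import numFieldNormedType.Exports.

Local Open Scope classical_set_scope.
Local Open Scope ring_scope.
Local Open Scope complex_scope.
Local Open Scope ereal_scope.

(* MathComp-Analysis, with [R[i]] over an arbitrary [R : realType] as the
   complex numbers.

   Rows, columns and the position along a diagonal are numbered from 0 instead
   of 1: [A j m] is the entry a_(j+1,m+1). The diagonal index k = m - j is not
   affected by this shift. All norms take values in [\bar R], +oo meaning that
   the object is not in the corresponding space. *)
Definition imatrix (R : realType) : Type := nat -> nat -> R[i].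

Section Definitions.
Variable R : realType.
Implicit Types (A B M : imatrix R) (x y : nat -> R[i]).

Definition cabs (z : R[i]) : \bar R := (Normc.normc z)%:E.

Definition upper_triangular A : Prop := forall j m, (m < j)%N -> A j m = 0%R.

Definition add_imatrix A B : imatrix R := fun j m => (A j m + B j m)%R.

Definition diag A (k : nat) : imatrix R :=
  fun j m => if m == (j + k)%N then A j m else 0%R.

Definition l2norm x : \bar R := sqrte (\sum_(m <oo) cabs (x m) ^+ 2).

(* [y = M x]: each row of the product is a convergent series of complex
   numbers. *)
Definition is_mulmx M x y : Prop :=
  forall j, ((fun n => (\sum_(m < n) M j m * x m)%R) : nat -> R[i]^o) @ \oo
              --> (y j : R[i]^o).

(* The least bound of [M] as an operator on l_2. It is +oo (infimum of the
   empty set) unless [M] defines a bounded operator on l_2. *)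
Definition opnorm M : \bar R :=
  ereal_inf [set c%:E | c in [set c : R | (0 <= c)%R /\
    forall x, l2norm x < +oo ->
      exists2 y, is_mulmx M x y & l2norm y <= c%:E * l2norm x]].

(* The trace norm of the diagonal [diag A k], whose singular values are the
   moduli of its entries. *)
Definition diag_S1norm A (k : nat) : \bar R := \sum_(l <oo) cabs (A l (l + k)%N).

(* The dyadic block I_n is the interval [block_start n, 2^(n+1)[. *)
Definition block_start (n : nat) : nat := if n is 0 then 0 else 2 ^ n.

(* The l(2,1)-norm of a sequence given by its moduli. They are extended reals,
   because a sequence of trace norms of diagonals may contain +oo. *)
Definition ell21 (u : nat -> \bar R) : \bar R :=
  \sum_(n <oo) sqrte (\sum_(block_start n <= k < 2 ^ n.+1) u k ^+ 2).

Definition MS1norm A : \bar R := ell21 (diag_S1norm A).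

Definition rowseq A (j : nat) : nat -> R[i] := fun k => A j (j + k)%N.

Definition colseq A (m : nat) : nat -> R[i] :=
  fun k => if (k <= m)%N then A (m - k)%N m else 0%R.

Definition rownorm A : \bar R := \sum_(j <oo) ell21 (cabs \o rowseq A j).

Definition colnorm A : \bar R := \sum_(m <oo) ell21 (cabs \o colseq A m).

Definition MS1_21 : set (imatrix R) :=
  [set A | upper_triangular A /\ MS1norm A < +oo].

Definition R21 : set (imatrix R) :=
  [set A | upper_triangular A /\ rownorm A < +oo].

Definition C21 : set (imatrix R) :=
  [set A | upper_triangular A /\ colnorm A < +oo].

Definition R21_plus_C21 : set (imatrix R) :=
  [set add_imatrix A1 A2 | A1 in R21 & A2 in C21].

(* The entrywise sum over k >= 1 of k A_k r^(k-1); at the entry (j, m) the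
   terms with k > m vanish. *)
Definition bloch_deriv A (r : R) : imatrix R :=
  fun j m => (\sum_(1 <= k < m.+1) k%:R * diag A k j m * (r ^+ k.-1)%:C)%R.

Definition blochnorm A : \bar R :=
  ereal_sup [set (1 - r ^+ 2)%:E * opnorm (bloch_deriv A r)
            | r in [set r : R | (0 <= r < 1)%R]]
  + opnorm (diag A 0).

Definition bloch : set (imatrix R) :=
  [set A | upper_triangular A /\ blochnorm A < +oo].

Definition abs_pairing A B : \bar R :=
  \esum_(p in [set: nat * nat]) cabs (A p.1 p.2 * B p.1 p.2)%R.

Definition bloch_kothe : set (imatrix R) :=
  [set A | upper_triangular A /\ forall B, bloch B -> abs_pairing A B < +oo].

(* The natural norm of the Koethe dual. *)
Definition kothenorm A : \bar R :=
  ereal_sup [set abs_pairing A B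
            | B in [set B | bloch B /\ blochnorm B <= 1]].

End Definitions.

Arguments MS1_21 R : clear implicits.
Arguments R21 R : clear implicits.
Arguments C21 R : clear implicits.
Arguments R21_plus_C21 R : clear implicits.
Arguments bloch R : clear implicits.
Arguments bloch_kothe R : clear implicits.

(* Main.v *)
(** The first inclusion: the rows and columns of the operator [B'(r)] have
    l_2 norm at most its operator norm; with [r = 1 - 2^-(n+1)] this bounds the
    dyadic blocks of every row and column of a Bloch matrix [B], and
    Cauchy-Schwarz on each block concludes.

    The second inclusion: testing against the [k]-th diagonal of ones shows that
    [al_k = ||A_k||_S1] is finite. For each block there is a bounded function on
    a finite cyclic group whose Fourier coefficients [g_k] satisfy
    [sum al_k |g_k| >= c (sum al_k^2)^(1/2)]: take the phase of a polynomial
    with coefficients [+- al_k] whose signs keep its fourth moment small. The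
    Toeplitz matrix of [g], cut to rectangles of side comparable to [2^n] along
    its band, is uniformly bounded, and on such a rectangle the factor
    [(m-j) r^(m-j-1)] is a difference of two products of diagonal factors; so
    the sum of these matrices over the blocks of one parity is a Bloch matrix.

    The inclusion is strict because of [a_(k,2k) = 1/k], tested against the 0-1
    matrix supported on [(k,2k)]. Sparse rows (columns), each supported in a
    single dyadic block, lie in R(2,1) but not in C(2,1) (and conversely). *)

Require Import Defs.
From HB Require Import structures.
From mathcomp Require Import all_boot all_order all_algebra.
From mathcomp Require Import all_classical all_reals all_analysis.
From mathcomp Require Import complex.
From mathcomp Require cyclotomic separable.
From mathcomp Require Import ring lra zify.

Set Implicit Arguments.
Unset Strict Implicit.
Unset Printing Implicit Defensive.

Import Order.TTheory GRing.Theory Num.Theory.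
Import numFieldNormedType.Exports.

Local Open Scope classical_set_scope.
Local Open Scope ereal_scope.

(** * Moduli and the finite Fourier transform *)

Section ComplexModulus.
Local Open Scope ring_scope.
Local Open Scope complex_scope.
Variable R : realType.
Implicit Types (z : R[i]) (x : nat -> R[i]).

Notation nc := (@Normc.normc R).
Notation Re := (@complex.Re R).
Notation Im := (@complex.Im R).

Lemma nc_ge0 z : 0 <= nc z.
Proof. by case: z => a b; exact: sqrtr_ge0. Qed.

Lemma ncM z1 z2 : nc (z1 * z2) = nc z1 * nc z2.
Proof. exact: Normc.normcM. Qed.

Lemma ncX z n : nc (z ^+ n) = nc z ^+ n.
Proof. by elim: n => [|n IH]; rewrite ?expr0 ?Normc.normc1// !exprS ncM IH. Qed.

Lemma ncD z1 z2 : nc (z1 + z2) <= nc z1 + nc z2.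
Proof. exact: le_normcD. Qed.

Lemma nc_real (a : R) : nc a%:C = `|a|.
Proof. by rewrite /= expr0n/= addr0 sqrtr_sqr. Qed.

Lemma nc_conj z : nc z^* = nc z.
Proof. by case: z => a b /=; rewrite sqrrN. Qed.

Lemma nc_sqrE z : nc z ^+ 2 = Re z ^+ 2 + Im z ^+ 2.
Proof. by case: z => a b /=; rewrite sqr_sqrtr// addr_ge0 ?sqr_ge0. Qed.

Lemma nc_sqr_conj z : (nc z ^+ 2)%:C = z * z^*.
Proof. by rewrite rmorphXn/= -sqr_normc. Qed.

Lemma nc_sum (I : Type) (r : seq I) (P : pred I) (F : I -> R[i]) :
  nc (\sum_(i <- r | P i) F i) <= \sum_(i <- r | P i) nc (F i).
Proof.
elim/big_rec2: _ => [|i y1 y2 _ IH]; first by rewrite Normc.normc0.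
by apply: le_trans (ncD _ _) _; rewrite lerD2l.
Qed.

Lemma ncM_le z1 z2 : 2 * (nc z1 * nc z2) <= nc z1 ^+ 2 + nc z2 ^+ 2.
Proof. by have := sqr_ge0 (nc z1 - nc z2); rewrite sqrrB; nra. Qed.

Lemma le_nc_sqr2 z1 z2 : nc z1 <= nc z2 -> nc z1 ^+ 2 <= nc z2 ^+ 2.
Proof. by move=> h; rewrite lerXn2r ?nnegrE ?nc_ge0. Qed.

Lemma nc_le_ReIm z : nc z <= `|Re z| + `|Im z|.
Proof.
rewrite -(@ler_pXn2r _ 2)// ?nnegrE ?nc_ge0 ?addr_ge0// nc_sqrE sqrrD.
rewrite !real_normK ?num_real//.
by have := mulr_ge0 (normr_ge0 (Re z)) (normr_ge0 (Im z)); nra.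
Qed.

Lemma Re_le_nc z : `|Re z| <= nc z.
Proof.
rewrite -(@ler_pXn2r _ 2)// ?nnegrE ?nc_ge0// nc_sqrE real_normK ?num_real//.
by rewrite lerDl sqr_ge0.
Qed.

Lemma Im_le_nc z : `|Im z| <= nc z.
Proof.
rewrite -(@ler_pXn2r _ 2)// ?nnegrE ?nc_ge0// nc_sqrE real_normK ?num_real//.
by rewrite lerDr sqr_ge0.
Qed.

End ComplexModulus.

Section FourierTransform.
Local Open Scope ring_scope.
Local Open Scope complex_scope.
Variable R : realType.
Implicit Types (z : R[i]) (x : nat -> R[i]).
Notation nc := (@Normc.normc R).

(** In characteristic 0 the polynomial X^N - 1 is separable, so it has N distinct roots, and a group
    of that many N-th roots of unity contains a primitive one. *)
Lemma prim_root_exists N : (0 < N)%N -> {w : R[i] | N.-primitive_root w}.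
Proof.
pose p : {poly R[i]} := ('X^N - 1)%R; have [r Dp] := closed_field_poly_normal p.
move=> N_gt0; apply/sigW; rewrite (monicP _) ?monicXnsubC // scale1r in Dp.
have rn1 : all N.-unity_root r.
  by apply/allP=> z; rewrite -root_prod_XsubC -Dp.
have sz_r : (N < (size r).+1)%N.
  by rewrite -(size_prod_XsubC r id) -Dp size_XnsubC.
have [|z] := hasP (cyclic.has_prim_root N_gt0 rn1 _ sz_r); last by exists z.
rewrite -separable.separable_prod_XsubC -Dp cyclotomic.separable_Xn_sub_1//.
by rewrite pnatr_eq0 -lt0n.
Qed.

Variables (N : nat) (w : R[i]).
Hypothesis N_gt0 : (0 < N)%N.
Hypothesis w_prim : N.-primitive_root w.

Lemma nc_prim_root : nc w = 1.
Proof.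
apply/eqP; rewrite -(@pexpr_eq1 _ _ N)// ?nc_ge0// -ncX prim_expr_order//.
by rewrite Normc.normc1.
Qed.

Lemma nc_prim_rootX k : nc (w ^+ k) = 1.
Proof. by rewrite ncX nc_prim_root expr1n. Qed.

Lemma mul_prim_root_conj k : w ^+ k * (w ^+ k)^* = 1.
Proof. by rewrite -nc_sqr_conj nc_prim_rootX expr1n. Qed.

(** The terms are the powers of z = w^m conj(w^k); z differs from 1 and z^N = 1, so multiplication
    by z - 1 telescopes to 0. *)
Lemma prim_root_orthogonal m k : m <> k %[mod N] ->
  \sum_(t < N) w ^+ (m * t) * (w ^+ (k * t))^* = 0.
Proof.
move=> mk; set z := w ^+ m * (w ^+ k)^*.
have z1 : z - 1 != 0.
  rewrite subr_eq0; apply/eqP => zE; apply: mk; apply/eqP.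
  rewrite -(eq_prim_root_expr w_prim) -[w ^+ m]mulr1 -(mul_prim_root_conj k).
  by rewrite [w ^+ k * _]mulrC mulrA -/z zE mul1r.
apply: (mulfI z1); rewrite mulr0.
rewrite -[RHS](_ : z ^+ N - 1 = 0); last first.
  rewrite exprMn -rmorphXn -!exprM ![(_ * N)%N]mulnC !exprM.
  by rewrite (prim_expr_order w_prim) !expr1n rmorph1 mulr1 subrr.
rewrite subrX1; congr (_ * _); apply: eq_bigr => t _.
by rewrite exprMn -rmorphXn -!exprM.
Qed.

(** The hypothesis asks that the support of x inject into Z/N, because x will later live on a window
    placed anywhere, not on the initial indices. *)
Lemma parseval n x :
    (forall m k, (m < n)%N -> (k < n)%N -> x m != 0 -> x k != 0 ->
      m = k %[mod N] -> m = k) ->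
  \sum_(t < N) nc (\sum_(m < n) x m * w ^+ (m * t)) ^+ 2
    = N%:R * \sum_(m < n) nc (x m) ^+ 2.
Proof.
move=> xinj; apply: complexI.
rewrite rmorph_sum /= rmorphM /= rmorph_sum /= rmorph_nat.
under eq_bigr => t _.
  rewrite nc_sqr_conj rmorph_sum big_distrlr /=.
  over.
rewrite exchange_big mulr_sumr /=; apply: eq_bigr => m _.
rewrite exchange_big (bigD1 m)//= [X in _ + X]big1 ?addr0; last first.
  move=> k km.
  under eq_bigr => t _ do rewrite rmorphM mulrACA.
  rewrite -mulr_sumr.
  have [->|xm] := eqVneq (x m) 0; first by rewrite !mul0r.
  have [->|xk] := eqVneq (x k) 0; first by rewrite rmorph0 mulr0 mul0r.
  rewrite prim_root_orthogonal ?mulr0// => /esym E.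
  by move: km; rewrite -val_eqE /= (xinj _ _ _ _ _ _ E)// eqxx.
under eq_bigr => t _ do
  rewrite rmorphM mulrACA mul_prim_root_conj mulr1 -nc_sqr_conj.
by rewrite sumr_const card_ord mulr_natl.
Qed.

End FourierTransform.

(** * Bounded functions on Z/N with large Fourier coefficients *)

Section LargeCoefficients.
Local Open Scope ring_scope.
Local Open Scope complex_scope.
Variable R : realType.
Implicit Types (z c : R[i]) (al : nat -> R).
Notation nc := (@Normc.normc R).

(** Averaging over the two signs of c cancels the odd terms; the two sides differ by 8 (|z|^2 |c|^2
    - (Re z conj c)^2), nonnegative by Cauchy-Schwarz. *)
Lemma fourth_moment_step z c :
  nc (z + c) ^+ 4 + nc (z - c) ^+ 4
    <= 2 * (nc z ^+ 4 + 6 * nc z ^+ 2 * nc c ^+ 2 + nc c ^+ 4).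
Proof.
rewrite -[4%N]/(2 * 2)%N !exprM !nc_sqrE.
case: z c => [a b] [p q] /=.
have D2 : (a * p + b * q) ^+ 2 <= (a ^+ 2 + b ^+ 2) * (p ^+ 2 + q ^+ 2).
  by rewrite -subr_ge0; have := sqr_ge0 (a * q - b * p); congr (_ <= _); ring.
rewrite -subr_ge0.
suff -> : 2 * ((a ^+ 2 + b ^+ 2) ^+ 2 +
       6 * (a ^+ 2 + b ^+ 2) * (p ^+ 2 + q ^+ 2) + (p ^+ 2 + q ^+ 2) ^+ 2) -
    (((a + p) ^+ 2 + (b + q) ^+ 2) ^+ 2 + ((a - p) ^+ 2 + (b - q) ^+ 2) ^+ 2)
  = 8 * ((a ^+ 2 + b ^+ 2) * (p ^+ 2 + q ^+ 2) - (a * p + b * q) ^+ 2).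
  by rewrite mulr_ge0// subr_ge0.
by ring.
Qed.

Variables (N : nat) (w : R[i]).
Hypothesis N_gt0 : (0 < N)%N.
Hypothesis w_prim : N.-primitive_root w.

Lemma parseval_initial K (be : nat -> R) : (K <= N)%N ->
  \sum_(t < N) nc (\sum_(k < K) (be k)%:C * w ^+ (k * t)) ^+ 2
    = N%:R * \sum_(k < K) be k ^+ 2.
Proof.
move=> KN; rewrite (@parseval _ _ _ N_gt0 w_prim _ (fun k => (be k)%:C)).
  by congr (_ * _); apply: eq_bigr => k _; rewrite nc_real real_normK ?num_real.
move=> m k mK kK _ _; rewrite !modn_small//; exact: leq_trans KN.
Qed.

(** A fourth-moment Khintchine inequality with the signs chosen one at a time: the mean over the two
    signs of a new coefficient a obeys the bound, since 3 s2^2 + 6 s2 a^2 + a^4 <= 3 (s2 + a^2)^2,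
    so one of the signs does. *)
Lemma small_fourth_moment_signs al K : (K <= N)%N ->
  exists2 eps : nat -> R, forall k, `|eps k| = 1 &
    \sum_(t < N) nc (\sum_(k < K) (eps k * al k)%:C * w ^+ (k * t)) ^+ 4
      <= 3 * N%:R * (\sum_(k < K) al k ^+ 2) ^+ 2.
Proof.
elim: K => [|K IH] KN.
  exists (fun=> 1) => [k|]; first by rewrite normr1.
  rewrite big1 => [|t _]; last by rewrite big_ord0 Normc.normc0 expr0n.
  by rewrite big_ord0 expr0n mulr0.
have [eps eps1 H] := IH (ltnW KN).
pose f t := \sum_(k < K) (eps k * al k)%:C * w ^+ (k * t).
pose c t := (al K)%:C * w ^+ (K * t).
set s2 := \sum_(k < K) al k ^+ 2 in H.
have f2 : \sum_(t < N) nc (f t) ^+ 2 = N%:R * s2.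
  rewrite (@parseval_initial _ (fun k => eps k * al k)) 1?ltnW//.
  congr (_ * _); apply: eq_bigr => k _.
  by rewrite exprMn -(real_normK (num_real (eps k))) eps1 expr1n mul1r.
have ncc t : nc (c t) ^+ 2 = al K ^+ 2.
  by rewrite ncM (nc_prim_rootX N_gt0 w_prim) mulr1 nc_real real_normK ?num_real.
have both : \sum_(t < N) nc (f t + c t) ^+ 4 + \sum_(t < N) nc (f t - c t) ^+ 4
    <= 2 * (3 * N%:R * (s2 + al K ^+ 2) ^+ 2).
  rewrite -big_split /=.
  apply: (@le_trans _ _ (\sum_(t < N) 2 * (nc (f t) ^+ 4 +
      6 * nc (f t) ^+ 2 * al K ^+ 2 + al K ^+ 4))).
    apply: ler_sum => t _; apply: le_trans (fourth_moment_step _ _) _.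
    rewrite (_ : nc (c t) ^+ 4 = (nc (c t) ^+ 2) ^+ 2); last by rewrite -exprM.
    by rewrite ncc -exprM.
  rewrite -mulr_sumr !big_split /= -mulr_suml -mulr_sumr f2.
  rewrite sumr_const card_ord.
  have N0 : (0 : R) <= N%:R by [].
  have a0 : 0 <= al K ^+ 4 * N%:R by rewrite mulr_ge0// exprn_even_ge0.
  rewrite ler_pM2l//; apply: le_trans (_ : 3 * N%:R * s2 ^+ 2 +
    6 * (N%:R * s2) * al K ^+ 2 + N%:R * al K ^+ 4 <= _).
    by rewrite [N%:R * al K ^+ 4]mulr_natl !lerD2r; exact: H.
  rewrite -subr_ge0 (_ : _ - _ = 2 * (al K ^+ 4 * N%:R)); last by ring.
  by rewrite mulr_ge0.
have [e e1 He] : exists2 e : R, `|e| = 1 & \sum_(t < N)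
    nc (f t + (e * al K)%:C * w ^+ (K * t)) ^+ 4
      <= 3 * N%:R * (s2 + al K ^+ 2) ^+ 2.
  have [h|h] := leP (\sum_(t < N) nc (f t + c t) ^+ 4)
                  (3 * N%:R * (s2 + al K ^+ 2) ^+ 2).
    by exists 1; [rewrite normr1|rewrite mul1r].
  exists (-1); first by rewrite normrN1.
  rewrite mulN1r rmorphN /=; under eq_bigr => t _ do rewrite mulNr -/(c t).
  by move: h both; set X := \sum_(t < N) _; set Y := \sum_(t < N) _; lra.
exists (fun k => if k == K then e else eps k) => [k|]; first by case: ifP.
rewrite big_ord_recr /= -/s2; apply: le_trans He; apply: ler_sum => t _.
rewrite big_ord_recr /= eqxx; rewrite le_eqVlt; apply/orP; left; apply/eqP; congr (nc (_ + _) ^+ 4).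
by apply: eq_bigr => k _; rewrite ltn_eqF.
Qed.

Definition fourier_coef (h : nat -> R[i]) (k : nat) : R[i] :=
  (N%:R^-1)%:C * \sum_(t < N) h t * w ^+ (k * t).

(* The unimodular function is the phase of a polynomial [f] with
   coefficients [+- al]: its coefficients pair with [al] to at least the L^1 mean
   of [f], which dominates the l_2 norm of [al] since the fourth moment of [f]
   is comparable to the square of the second one. *)
Lemma large_fourier_coefs al : (forall k, 0 <= al k) ->
  exists2 h : nat -> R[i], forall t, nc (h t) <= 1 &
    9 * Num.sqrt (\sum_(k < N) al k ^+ 2)
      <= 16 * \sum_(k < N) al k * nc (fourier_coef h k).
Proof.
move=> al0; have [eps eps1 H] := small_fourth_moment_signs al (leqnn N).
pose f t := \sum_(k < N) (eps k * al k)%:C * w ^+ (k * t).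
set s2 := \sum_(k < N) al k ^+ 2 in H *; set s := Num.sqrt s2.
have s2_ge0 : 0 <= s2 by apply: sumr_ge0 => k _; exact: sqr_ge0.
have s_ge0 : 0 <= s := sqrtr_ge0 _.
have sE : s ^+ 2 = s2 by rewrite sqr_sqrtr.
have f2 : \sum_(t < N) nc (f t) ^+ 2 = N%:R * s2.
  rewrite (@parseval_initial _ (fun k => eps k * al k))//.
  congr (_ * _); apply: eq_bigr => k _.
  by rewrite exprMn -(real_normK (num_real (eps k))) eps1 expr1n mul1r.
have NR : (0 : R) < N%:R by rewrite ltr0n.
(* Where [f] vanishes, the inverse of 0 is 0, so [h] is 0 there and |h| <= 1 still holds. *)
pose h t := (f t)^* * ((nc (f t))^-1)%:C.
have hE t : h t * f t = (nc (f t))%:C.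
  rewrite /h mulrAC [_^* * _]mulrC -nc_sqr_conj -rmorphM; congr _%:C.
  have [->|n0] := eqVneq (nc (f t)) 0; first by rewrite expr0n mul0r.
  by rewrite expr2 mulfK.
exists h => [t|].
  rewrite ncM nc_conj nc_real ger0_norm ?invr_ge0 ?nc_ge0//.
  have [->|n0] := eqVneq (nc (f t)) 0; first by rewrite mul0r.
  by rewrite divff.
have [s0|s0] := eqVneq s 0.
  rewrite s0 mulr0 mulr_ge0// sumr_ge0// => k _.
  by rewrite mulr_ge0// nc_ge0.
have {s0}s_gt0 : 0 < s by rewrite lt_neqAle eq_sym s0.
(* Pointwise 12 s^2 x^2 - x^4 <= 16 s^3 x for x = |f t|, the difference being x (x - 2 s)^2 (x + 4
   s); by the two moments the left sides sum to at least (12 - 3) N s^4. *)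
have l1 : 9 * s * N%:R <= 16 * \sum_(t < N) nc (f t).
  rewrite -(@ler_pM2r _ (s ^+ 3)) ?exprn_gt0//.
  apply: (@le_trans _ _ (\sum_(t < N) (12 * s2 * nc (f t) ^+ 2 - nc (f t) ^+ 4))).
    rewrite sumrB -mulr_sumr f2.
    move: H; rewrite -/(f _) -sE; set X := \sum_(i < N) _; nra.
  rewrite [16 * _ * _]mulrAC [leRHS]mulr_sumr; apply: ler_sum => t _; rewrite -sE.
  have x0 := nc_ge0 (f t); set x := nc _ in x0 *.
  have fac : 0 <= x * (x - 2 * s) ^+ 2 * (x + 4 * s).
    by apply: mulr_ge0; [apply: mulr_ge0; rewrite ?sqr_ge0|lra].
  by nra.
have pairing : \sum_(t < N) nc (f t)
    <= N%:R * \sum_(k < N) al k * nc (fourier_coef h k).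
  have -> : \sum_(t < N) nc (f t) = nc (\sum_(t < N) h t * f t).
    under [in RHS]eq_bigr => t _ do rewrite hE.
    rewrite -rmorph_sum nc_real ger0_norm// sumr_ge0// => t _.
    exact: nc_ge0.
  have -> : \sum_(t < N) h t * f t
      = \sum_(k < N) (eps k * al k)%:C * \sum_(t < N) h t * w ^+ (k * t).
    under eq_bigr => t _ do rewrite mulr_sumr.
    rewrite exchange_big; apply: eq_bigr => k _; rewrite mulr_sumr.
    by apply: eq_bigr => t _; rewrite mulrCA.
  apply: le_trans (nc_sum _ _ _) _; rewrite mulr_sumr; apply: ler_sum => k _.
  rewrite ncM nc_real normrM eps1 mul1r ger0_norm// mulrCA ler_wpM2l//.
  rewrite ncM nc_real ger0_norm ?invr_ge0// mulrA divff ?mul1r//.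
  by rewrite gt_eqF.
rewrite -(@ler_pM2r _ N%:R)//; apply: le_trans l1 _.
by rewrite -mulrA ler_pM2l// mulrC.
Qed.

End LargeCoefficients.

(** * Bilinear forms and operator norms *)

Section BilinearForms.
Local Open Scope ring_scope.
Local Open Scope complex_scope.
Variable R : realType.
Implicit Types (M : imatrix R) (x y : nat -> R[i]) (c : R).
Notation nc := (@Normc.normc R).

Lemma sum_trunc (V : nmodType) n k (F : nat -> V) : (k <= n)%N ->
  \sum_(j < n) (if (j < k)%N then F j else 0) = \sum_(j < k) F j.
Proof. by move=> kn; rewrite [RHS](big_ord_widen n F kn) [RHS]big_mkcond. Qed.

(* The quadratic right-hand side makes the bound additive in [M] and
   summable over orthogonal pieces of [x] and [y]; by homogeneity it is
   equivalent to [|form M n x y| <= c |x| |y|]. *)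
Definition form_bound M c : Prop := forall n x y,
  2 * nc (\sum_(j < n) \sum_(m < n) y j * M j m * x m)
    <= c * (\sum_(m < n) nc (x m) ^+ 2 + \sum_(m < n) nc (y m) ^+ 2).

Lemma sum_nc_sqr_ge0 n x : 0 <= \sum_(m < n) nc (x m) ^+ 2.
Proof. by apply: sumr_ge0 => m _; exact: sqr_ge0. Qed.

Lemma form_bound_le M c c' : form_bound M c -> c <= c' -> form_bound M c'.
Proof.
move=> Mc cc' n x y; apply: le_trans (Mc n x y) _.
by rewrite ler_wpM2r// addr_ge0 ?sum_nc_sqr_ge0.
Qed.

Lemma form_bound_scale M c (a : R) : 0 <= a -> form_bound M c ->
  form_bound (fun j m => a%:C * M j m) (a * c).
Proof.
move=> a0 Mc n x y.
rewrite (_ : \sum_(j < n) _ = a%:C * \sum_(j < n) \sum_(m < n) y j * M j m * x m).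
  rewrite ncM nc_real ger0_norm// mulrCA -[a * c * _]mulrA; apply: ler_wpM2l => //.
rewrite mulr_sumr; apply: eq_bigr => j _; rewrite mulr_sumr.
by apply: eq_bigr => m _; ring.
Qed.

Lemma form_bound_sum (I : Type) (r : seq I) (P : pred I)
    (M : I -> imatrix R) (c : I -> R) :
    (forall i, P i -> form_bound (M i) (c i)) ->
  form_bound (fun j m => \sum_(i <- r | P i) M i j m) (\sum_(i <- r | P i) c i).
Proof.
move=> Mc n x y.
have -> : \sum_(j < n) \sum_(m < n) y j * (\sum_(i <- r | P i) M i j m) * x m
  = \sum_(i <- r | P i) \sum_(j < n) \sum_(m < n) y j * M i j m * x m.
  rewrite [RHS]exchange_big; apply: eq_bigr => j _; rewrite [RHS]exchange_big.
  by apply: eq_bigr => m _; rewrite mulr_sumr mulr_suml.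
apply: le_trans (ler_wpM2l _ (nc_sum _ _ _)) _ => //.
by rewrite mulr_sumr mulr_suml; apply: ler_sum => i /Mc.
Qed.

Lemma eq_form_bound M M' c : (forall j m, M j m = M' j m) ->
  form_bound M c -> form_bound M' c.
Proof.
move=> MM' Mc n x y; move: (Mc n x y).
by under eq_bigr => j _ do under eq_bigr => m _ do rewrite MM'.
Qed.

(** Schur's test: 2 |x m| |y j| <= |x m|^2 + |y j|^2 is weighted by |M j m| and summed over rows and
    columns. *)
Lemma form_bound_schur M c :
    (forall n j, \sum_(m < n) nc (M j m) <= c) ->
    (forall n m, \sum_(j < n) nc (M j m) <= c) ->
  form_bound M c.
Proof.
move=> rowM colM n x y.
apply: (@le_trans _ _ (\sum_(j < n) \sum_(m < n)
    (nc (M j m) * nc (x m) ^+ 2 + nc (M j m) * nc (y j) ^+ 2))).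
  apply: le_trans (ler_wpM2l _ (nc_sum _ _ _)) _ => //.
  rewrite mulr_sumr; apply: ler_sum => j _.
  apply: le_trans (ler_wpM2l _ (nc_sum _ _ _)) _ => //.
  rewrite mulr_sumr; apply: ler_sum => m _; rewrite !ncM.
  have := ncM_le (x m) (y j); have := nc_ge0 (M j m); rewrite -mulrDr.
  move=> h1 h2; rewrite (_ : 2 * _ = nc (M j m) * (2 * (nc (x m) * nc (y j)))).
    by rewrite ler_wpM2l.
  by ring.
under eq_bigr => j _ do rewrite big_split /=.
rewrite big_split /= mulrDr lerD//.
  rewrite exchange_big mulr_sumr /=; apply: ler_sum => m _.
  by rewrite -mulr_suml; apply: ler_wpM2r; [exact: sqr_ge0|exact: colM].
rewrite mulr_sumr; apply: ler_sum => j _.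
by rewrite -mulr_suml; apply: ler_wpM2r; [exact: sqr_ge0|exact: rowM].
Qed.

(** The form is tested on y = conj(M x) / c, where 1 / c balances the two squares: 2 T / c <= c (X +
    T / c^2) gives T <= c^2 X. Padding by zeros turns the J x N rectangle into a square. *)
Lemma form_bound_mulmx M c J N x : 0 < c -> form_bound M c ->
  \sum_(j < J) nc (\sum_(m < N) M j m * x m) ^+ 2
    <= c ^+ 2 * \sum_(m < N) nc (x m) ^+ 2.
Proof.
move=> c0 Mc; set S := fun j => \sum_(m < N) M j m * x m.
pose x' m := if (m < N)%N then x m else 0.
pose y' j := if (j < J)%N then (c^-1)%:C * (S j)^* else 0.
have := Mc (J + N)%N x' y'.
have -> : \sum_(j < J + N) \sum_(m < J + N) y' j * M j m * x' m
   = (c^-1 * \sum_(j < J) nc (S j) ^+ 2)%:C.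
  rewrite (eq_bigr (fun j : 'I_(J + N) => if (j < J)%N then
      (c^-1 * nc (S j) ^+ 2)%:C else 0)); last first.
    move=> j _; rewrite /y'; case: ifP => jJ; last first.
      by rewrite big1// => m _; rewrite !mul0r.
    rewrite [RHS]rmorphM /= nc_sqr_conj.
    rewrite (eq_bigr (fun m : 'I_(J + N) => (c^-1)%:C * (S j)^* *
      (if (m < N)%N then M j m * x m else 0))); last first.
      by move=> m _; rewrite /x'; case: ifP => _; rewrite ?mulr0// mulrA.
    rewrite -mulr_sumr (sum_trunc (fun m => M j m * x m)) ?leq_addl// -/(S j).
    by rewrite -mulrA [(S j)^* * _]mulrC.
  rewrite (sum_trunc (fun j => (c^-1 * nc (S j) ^+ 2)%:C)) ?leq_addr//.
  by rewrite -rmorph_sum mulr_sumr.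
have -> : \sum_(m < J + N) nc (x' m) ^+ 2 = \sum_(m < N) nc (x m) ^+ 2.
  rewrite -(sum_trunc (fun m => nc (x m) ^+ 2) (leq_addl J N)).
  apply: eq_bigr => m _; rewrite /x'; case: ifP => // _.
  by rewrite Normc.normc0 expr0n.
have -> : \sum_(m < J + N) nc (y' m) ^+ 2
    = c^-1 ^+ 2 * \sum_(j < J) nc (S j) ^+ 2.
  rewrite mulr_sumr.
  rewrite -(sum_trunc (fun m => c^-1 ^+ 2 * nc (S m) ^+ 2) (leq_addr N J)).
  apply: eq_bigr => m _; rewrite /y'; case: ifP => // _; last first.
    by rewrite Normc.normc0 expr0n.
  by rewrite ncM nc_conj nc_real exprMn real_normK ?num_real.
have S0 : 0 <= \sum_(j < J) nc (S j) ^+ 2 by apply: sumr_ge0 => j _; exact: sqr_ge0.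
have ci : c * c^-1 = 1 by rewrite divff// gt_eqF.
rewrite nc_real ger0_norm; last by rewrite mulr_ge0 ?invr_ge0 ?(ltW c0).
set X := \sum_(m < N) _; set T := \sum_(j < J) _ => h.
have {}h : c * (2 * (c^-1 * T)) <= c * (c * (X + c^-1 ^+ 2 * T)).
  by rewrite ler_wpM2l// ltW.
rewrite (_ : c * (2 * _) = 2 * (c * c^-1) * T) in h; last by ring.
rewrite (_ : c * (c * _) = c ^+ 2 * X + (c * c^-1) ^+ 2 * T) in h; last by ring.
by move: h; rewrite ci; lra.
Qed.

End BilinearForms.

(** * Finite sections and the operator norm on l_2 *)

Section OperatorNorm.
Local Open Scope ring_scope.
Local Open Scope complex_scope.
Variable R : realType.
Implicit Types (M : imatrix R) (x y : nat -> R[i]) (c : R).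
Notation nc := (@Normc.normc R).

Lemma nneseries_le_bound (u : nat -> \bar R) (b : \bar R) :
    (forall i, (0 <= u i)%E) ->
    (forall n, (\sum_(0 <= i < n) u i <= b)%E) ->
  (\sum_(i <oo) u i <= b)%E.
Proof.
move=> u0 ub; apply: lime_le; first exact: is_cvg_nneseries.
by apply: nearW => n; exact: ub.
Qed.

Lemma sum_cabs_sqr n x :
  (\sum_(0 <= m < n) cabs (x m) ^+ 2)%E = (\sum_(m < n) nc (x m) ^+ 2)%:E.
Proof.
by rewrite big_mkord -sumEFin; apply: eq_bigr => m _; rewrite EFin_expe.
Qed.

Lemma cabs_sqr_ge0 (z : R[i]) : (0 <= cabs z ^+ 2)%E.
Proof. by rewrite -EFin_expe lee_fin sqr_ge0. Qed.

Lemma l2norm_ge n x :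
  ((Num.sqrt (\sum_(m < n) nc (x m) ^+ 2))%:E <= l2norm x)%E.
Proof.
rewrite -[X in (X <= _)%E]/(sqrte (\sum_(m < n) nc (x m) ^+ 2)%:E) lee_sqrt.
  rewrite -sum_cabs_sqr; apply: nneseries_lim_ge => m _ _; exact: cabs_sqr_ge0.
by apply: nneseries_ge0 => m _ _; exact: cabs_sqr_ge0.
Qed.

Lemma l2norm_le x (b : R) : (forall n, \sum_(m < n) nc (x m) ^+ 2 <= b) ->
  (l2norm x <= (Num.sqrt b)%:E)%E.
Proof.
move=> xb; have b0 : 0 <= b by have := xb 0%N; rewrite big_ord0.
rewrite -[X in (_ <= X)%E]/(sqrte b%:E) lee_sqrt ?lee_fin//.
apply: nneseries_le_bound => [m|n]; first exact: cabs_sqr_ge0.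
by rewrite sum_cabs_sqr lee_fin.
Qed.

Lemma l2norm_fin x : (l2norm x < +oo)%E ->
  exists2 b : R, 0 <= b /\ l2norm x = (Num.sqrt b)%:E &
    forall n, \sum_(m < n) nc (x m) ^+ 2 <= b.
Proof.
rewrite /l2norm; set s := (\sum_(m <oo) _)%E => sfin.
have s0 : (0 <= s)%E by apply: nneseries_ge0 => m _ _; exact: cabs_sqr_ge0.
have sf : s \is a fin_num by rewrite -sqrte_fin_num// ge0_fin_numE// sqrte_ge0.
exists (fine s) => [|n].
  split; first exact: fine_ge0.
  by rewrite -{1}(fineK sf).
rewrite -lee_fin fineK// -sum_cabs_sqr.
by apply: nneseries_lim_ge => m _ _; exact: cabs_sqr_ge0.
Qed.

Lemma l2norm_finsupp n x : (forall m, (n <= m)%N -> x m = 0) ->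
  l2norm x = (Num.sqrt (\sum_(m < n) nc (x m) ^+ 2))%:E.
Proof.
move=> x0; apply/eqP; rewrite eq_le l2norm_ge andbT; apply: l2norm_le => k.
apply: (@le_trans _ _ (\sum_(m < n + k) nc (x m) ^+ 2)).
  rewrite [leLHS](big_ord_widen _ (fun m => nc (x m) ^+ 2) (leq_addl n k)).
  rewrite [leLHS]big_mkcond /=.
  by apply: ler_sum => m _; case: ifP => // _; exact: sqr_ge0.
rewrite [leRHS](big_ord_widen _ (fun m => nc (x m) ^+ 2) (leq_addr k n)) [leRHS]big_mkcond /=.
apply: ler_sum => m _; case: ltnP => // /x0 ->.
by rewrite Normc.normc0 expr0n.
Qed.

Lemma cvg_complex (u : nat -> R[i]) (a b : R) :
    (fun n => complex.Re (u n)) @ \oo --> a ->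
    (fun n => complex.Im (u n)) @ \oo --> b ->
  (u : nat -> R[i]^o) @ \oo --> ((a +i* b)%C : R[i]^o).
Proof.
(* In the partial order of R[i] a positive [e] is real. *)
move=> /cvgrPdist_lt ua /cvgrPdist_lt ub; apply/cvgrPdist_lt => e e0.
have eE : e = (complex.Re e)%:C by rewrite RRe_real// gtr0_real.
have e'0 : 0 < complex.Re e / 2 by rewrite divr_gt0//; move: e0; rewrite eE ltcR.
near=> n.
have -> : `|(a +i* b)%C - u n| = (nc ((a +i* b)%C - u n))%:C by [].
rewrite eE ltcR; apply: le_lt_trans (nc_le_ReIm _) _.
rewrite [ltRHS](splitr (complex.Re e)) ltrD//.
  have -> : complex.Re ((a +i* b)%C - u n) = a - complex.Re (u n) by case: (u n).
  by near: n; exact: ua.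
have -> : complex.Im ((a +i* b)%C - u n) = b - complex.Im (u n) by case: (u n).
by near: n; exact: ub.
Unshelve. all: by end_near. Qed.

Lemma is_cvg_abs_bounded (f : nat -> R) (b : R) :
    (forall n, \sum_(m < n) `|f m| <= b) ->
  cvgn (fun n => \sum_(m < n) f m).
Proof.
move=> fb; rewrite (_ : (fun n => _) = series f); last first.
  by apply/funext => n; rewrite /series /= big_mkord.
apply: normed_cvg; apply: nondecreasing_is_cvgn.
  by apply/nondecreasing_seqP => n; rewrite /normed_series_of/= !seriesEord/= big_ord_recr/= lerDl.
exists b => _ [n _ <-]; rewrite /normed_series_of/= seriesEord. exact: fb.
Qed.

Lemma ReIm_sum n (F : nat -> R[i]) :
  complex.Re (\sum_(m < n) F m) = \sum_(m < n) complex.Re (F m) /\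
  complex.Im (\sum_(m < n) F m) = \sum_(m < n) complex.Im (F m).
Proof.
elim: n => [|n [IH1 IH2]]; first by rewrite !big_ord0.
rewrite !big_ord_recr /= -IH1 -IH2.
by case: (\sum_(i < n) F i) => a b; case: (F n).
Qed.

(** The series defining M x converge absolutely because the rows of M are square summable; the bound
    on finite sections then passes to the limit, first in the columns and then in the rows. *)
Lemma opnorm_le M c : 0 < c -> form_bound M c -> (opnorm M <= c%:E)%E.
Proof.
move=> c0 Mc; apply: ereal_inf_lbound; exists c => //; split; first exact: ltW.
move=> x /l2norm_fin [X [X0 xE] xX].
pose S j n := \sum_(m < n) M j m * x m.
have absS j n : \sum_(m < n) nc (M j m * x m) <= c ^+ 2 + X.
  pose u m := if nc (M j m) == 0 then 0 else (M j m)^*.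
  (* The section bound applied to the conjugate of the row itself gives s^2 <= c^2 s for its squared
     norm s. *)
  have row : \sum_(m < n) nc (M j m) ^+ 2 <= c ^+ 2.
    have [s0|s0] := eqVneq (\sum_(m < n) nc (M j m) ^+ 2) 0.
      by rewrite s0 sqr_ge0.
    have sp : 0 < \sum_(m < n) nc (M j m) ^+ 2.
      by rewrite lt_neqAle eq_sym s0 sumr_ge0// => m _; exact: sqr_ge0.
    have := form_bound_mulmx j.+1 n (fun m => (M j m)^*) c0 Mc.
    rewrite big_ord_recr /= => h.
    have {}h : nc (\sum_(m < n) M j m * (M j m)^*) ^+ 2
        <= c ^+ 2 * \sum_(m < n) nc (M j m) ^+ 2.
      under [X in _ <= _ * X]eq_bigr => m _ do rewrite -nc_conj.
      apply: le_trans h; rewrite lerDr sumr_ge0// => k _; exact: sqr_ge0.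
    move: h; rewrite (_ : \sum_(m < n) _ = (\sum_(m < n) nc (M j m) ^+ 2)%:C).
      by rewrite nc_real (gtr0_norm sp) expr2 ler_pM2r.
    by rewrite rmorph_sum; apply: eq_bigr => m _; rewrite [RHS]nc_sqr_conj.
  apply: (@le_trans _ _ (\sum_(m < n) (nc (M j m) ^+ 2 + nc (x m) ^+ 2))).
    apply: ler_sum => m _; rewrite ncM; apply: le_trans (ncM_le _ _).
    by rewrite ler_peMl ?mulr_ge0 ?nc_ge0// ler1n.
  by rewrite big_split lerD.
have cRe j : cvgn (fun n => complex.Re (S j n)).
  rewrite (_ : (fun n => _) = fun n => \sum_(m < n) complex.Re (M j m * x m)).
    apply: (@is_cvg_abs_bounded (fun m => complex.Re (M j m * x m)) (c ^+ 2 + X)) => n.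
    apply: le_trans (absS j n).
    by apply: ler_sum => m _; exact: Re_le_nc.
  by apply/funext => n; rewrite (ReIm_sum n (fun m => M j m * x m)).1.
have cIm j : cvgn (fun n => complex.Im (S j n)).
  rewrite (_ : (fun n => _) = fun n => \sum_(m < n) complex.Im (M j m * x m)).
    apply: (@is_cvg_abs_bounded (fun m => complex.Im (M j m * x m)) (c ^+ 2 + X)) => n.
    apply: le_trans (absS j n).
    by apply: ler_sum => m _; exact: Im_le_nc.
  by apply/funext => n; rewrite (ReIm_sum n (fun m => M j m * x m)).2.
exists (fun j => (limn (fun n => complex.Re (S j n)) +i*
                  limn (fun n => complex.Im (S j n)))%C).
  by move=> j; apply: cvg_complex; [exact: cRe|exact: cIm].
rewrite xE.
have -> : (c%:E * (Num.sqrt X)%:E = (Num.sqrt (c ^+ 2 * X))%:E)%E.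
  by rewrite sqrtrM ?sqr_ge0// sqrtr_sqr ger0_norm// ltW.
apply: l2norm_le => J.
have cv : (fun n => \sum_(j < J) nc (S j n) ^+ 2) @ \oo --> \sum_(j < J)
    nc (limn (fun n => complex.Re (S j n)) +i* limn (fun n => complex.Im (S j n)))%C ^+ 2.
  elim: {+}J => [|k IH].
    by rewrite big_ord0; under eq_fun do rewrite big_ord0; exact: cvg_cst.
  rewrite big_ord_recr; under eq_fun do rewrite big_ord_recr.
  apply: cvgD; first exact: IH.
  rewrite [X in _ --> X]nc_sqrE.
  rewrite (_ : (fun n => nc (S k n) ^+ 2) = fun n =>
    complex.Re (S k n) ^+ 2 + complex.Im (S k n) ^+ 2); last first.
    by apply/funext => n; exact: nc_sqrE.
  by apply: cvgD; [apply: cvgM; exact: cRe|apply: cvgM; exact: cIm].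
apply: (cvgr_to_le cv); apply: nearW => n.
by apply: le_trans (form_bound_mulmx J n x c0 Mc) _; rewrite ler_wpM2l ?sqr_ge0.
Qed.

Lemma is_mulmx_finsupp M n x y : (forall m, (n <= m)%N -> x m = 0) ->
  is_mulmx M x y -> forall j, y j = \sum_(m < n) M j m * x m.
Proof.
move=> x0 Mxy j; apply: (@norm_cvg_unique _ (R[i]^o) _ _ _ _ (Mxy j)) => /=.
apply: cvg_near_cst; near=> k.
have nk : (n <= k)%N by near: k; exists n.
rewrite (big_ord_widen _ (fun m => M j m * x m) nk) [RHS]big_mkcond /=.
by apply: eq_bigr => m _; case: ltnP => // /x0 ->; rewrite mulr0.
Unshelve. all: by end_near. Qed.

Lemma row_le_opnorm M n j :
  ((Num.sqrt (\sum_(m < n) nc (M j m) ^+ 2))%:E <= opnorm M)%E.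
Proof.
apply: le_ereal_inf_tmp => _ [c [c0 Mc] <-].
set s2 := \sum_(m < n) _; set s := Num.sqrt s2.
have s20 : 0 <= s2 by apply: sumr_ge0 => m _; exact: sqr_ge0.
(* The conjugate of the truncated row is mapped to a vector whose j-th entry is the squared norm of
   that row. *)
pose x m := if (m < n)%N then (M j m)^* else 0.
have xE : l2norm x = s%:E.
  rewrite (@l2norm_finsupp n) => [|m]; last by rewrite /x leqNgt => /negbTE ->.
  by congr (Num.sqrt _)%:E; apply: eq_bigr => m _; rewrite /x ltn_ord nc_conj.
have [|y Mxy yc] := Mc x; first by rewrite xE ltry.
have yj : y j = s2%:C.
  rewrite (@is_mulmx_finsupp M n x y _ Mxy) => [|m].
    rewrite rmorph_sum; apply: eq_bigr => m _.
    by rewrite /x ltn_ord /= -nc_sqr_conj.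
  by rewrite /x leqNgt => /negbTE ->.
have : (s2%:E <= c%:E * s%:E)%E.
  rewrite -xE; apply: le_trans yc; apply: le_trans (l2norm_ge j.+1 y).
  have -> : s2 = nc (y j) by rewrite yj nc_real ger0_norm.
  rewrite lee_fin -[leLHS]ger0_norm ?nc_ge0// -sqrtr_sqr ler_wsqrtr//.
  rewrite big_ord_recr /= lerDr.
  by apply: sumr_ge0 => m _; exact: sqr_ge0.
rewrite !lee_fin -{1}(sqr_sqrtr s20) -/s expr2.
have [->//|s0] := eqVneq s 0.
by rewrite ler_pM2r// lt_neqAle eq_sym s0 sqrtr_ge0.
Qed.

Lemma col_le_opnorm M n m :
  ((Num.sqrt (\sum_(j < n) nc (M j m) ^+ 2))%:E <= opnorm M)%E.
Proof.
apply: le_ereal_inf_tmp => _ [c [c0 Mc] <-].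
(* The m-th basis vector is mapped to the m-th column. *)
pose x k : R[i] := (k == m)%:R.
have x0 k : (m.+1 <= k)%N -> x k = 0 by rewrite /x => /gtn_eqF ->.
have xE : l2norm x = 1%:E.
  rewrite (@l2norm_finsupp m.+1 x x0) big_ord_recr /= big1 => [|k _].
    by rewrite /x eqxx Normc.normc1 expr1n add0r sqrtr1.
  by rewrite /x ltn_eqF// Normc.normc0 expr0n.
have [|y Mxy yc] := Mc x; first by rewrite xE ltry.
rewrite -[c%:E]mule1 -xE; apply: le_trans yc; apply: le_trans (l2norm_ge n y).
rewrite lee_fin ler_wsqrtr//; apply: ler_sum => j _.
rewrite (is_mulmx_finsupp x0 Mxy) big_ord_recr /= big1 => [|k _].
  by rewrite /x eqxx mulr1 add0r.
by rewrite /x ltn_eqF// mulr0.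
Qed.

End OperatorNorm.

(** * The pairing *)

Section Pairing.
Local Open Scope ring_scope.
Local Open Scope complex_scope.
Variable R : realType.
Implicit Types (A B : imatrix R).
Notation nc := (@Normc.normc R).

Lemma sum_ord_shift_le (F : nat -> R) l K L : (forall m, 0 <= F m) ->
  (l + K <= L)%N -> \sum_(k < K) F (l + k)%N <= \sum_(m < L) F m.
Proof.
move=> F0 lKL; rewrite -(subnKC lKL) big_split_ord big_split_ord /=.
rewrite -addrA [leRHS]addrC -addrA lerDl addr_ge0// sumr_ge0//.
Qed.

Lemma sum_ord_le (F : nat -> R) n L : (forall m, 0 <= F m) ->
  (n <= L)%N -> \sum_(k < n) F k <= \sum_(m < L) F m.
Proof. by move=> F0 nL; exact: (@sum_ord_shift_le F 0). Qed.

(** Every finite set of index pairs lies in a square, so these sections determine the unordered sum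
    [abs_pairing]. *)
Definition partial_pairing A B (N : nat) : R :=
  \sum_(j < N) \sum_(m < N) nc (A j m * B j m).

Let square (N : nat) : seq (nat * nat) :=
  [seq (i, j) | i <- iota 0 N, j <- iota 0 N].

Let fsum_square A B N :
  (\sum_(p \in [set` square N]) cabs (A p.1 p.2 * B p.1 p.2)%R)%E
    = (partial_pairing A B N)%:E.
Proof.
rewrite -fsbig_seq; last first.
  by apply: allpairs_uniq; [exact: iota_uniq|exact: iota_uniq|move=> [? ?] []].
rewrite big_allpairs_dep /= /partial_pairing -sumEFin -(big_mkord xpredT
  (fun j => (\sum_(m < N) nc (A j m * B j m))%:E)) /index_iota subn0.
apply: eq_bigr => j _; rewrite -sumEFin -(big_mkord xpredT
  (fun m => (nc (A j m * B j m))%:E)) /index_iota subn0.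
by [].
Qed.

Lemma partial_pairing_le A B N : ((partial_pairing A B N)%:E <= abs_pairing A B)%E.
Proof.
apply: esum_ge; exists [set` square N]; last by rewrite fsum_square.
by split; [exact: finite_seq|].
Qed.

Lemma abs_pairing_le A B (b : \bar R) :
  (forall N, ((partial_pairing A B N)%:E <= b)%E) -> (abs_pairing A B <= b)%E.
Proof.
move=> Nb; apply: ge_ereal_sup => _ [X [/finite_seqP[s ->] _] <-].
pose N := (\max_(p <- s) maxn p.1 p.2).+1.
apply: le_trans (Nb N); rewrite -fsum_square.
apply: lee_fsum_nneg_subset => [||p|p _].
- exact: finite_seq.
- exact: finite_seq.
- rewrite !inE /= => ps.
  have pN : (maxn p.1 p.2 < N)%N.
    rewrite ltnS; exact: (@leq_bigmax_seq _ s xpredT (fun p => maxn p.1 p.2) p).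
  apply/allpairsP; exists p; rewrite !mem_iota !add0n /=.
  by split; [exact: leq_ltn_trans (leq_maxl _ _) pN|
             exact: leq_ltn_trans (leq_maxr _ _) pN|case: p {ps pN}].
- by rewrite lee_fin nc_ge0.
Qed.

Lemma partial_pairing_add A1 A2 B N :
  partial_pairing (add_imatrix A1 A2) B N
    <= partial_pairing A1 B N + partial_pairing A2 B N.
Proof.
rewrite -big_split /=; apply: ler_sum => j _.
rewrite -big_split /=; apply: ler_sum => m _.
by rewrite mulrDl ncD.
Qed.

(* For each diagonal separately the partial sums over the columns increase
   to the trace norm, so the number of rows may be sent to infinity inside
   the finite sum over [k]. *)
Lemma diag_pairing_le A B K (ga : nat -> R) :
    (forall k, 0 <= ga k) ->
    (forall l k, (k < K)%N -> ga k <= nc (B l (l + k)%N)) ->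
  (\sum_(k < K) (ga k)%:E * diag_S1norm A k <= abs_pairing A B)%E.
Proof.
move=> ga0 gaB.
pose t (k : 'I_K) n := ((ga k)%:E * \sum_(0 <= l < n) cabs (A l (l + k)%N))%E.
have tE k n : t k n = (\sum_(l < n) ga k * nc (A l (l + k)%N))%:E.
  by rewrite /t big_mkord sumEFin -EFinM mulr_sumr.
have t_cvg k : t k @ \oo --> ((ga k)%:E * diag_S1norm A k)%E.
  by apply: cvgeMl => //; apply: is_cvg_nneseries => l _ _; rewrite lee_fin nc_ge0.
have t0 k : xpredT k -> \forall n \near \oo, (0 <= t k n)%E.
  move=> _; apply: nearW => n; rewrite tE lee_fin sumr_ge0// => l _.
  by rewrite mulr_ge0 ?nc_ge0.
apply: (cvge_le _ (cvg_nnesum t0 (fun k _ => t_cvg k))); apply: nearW => n.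
rewrite (eq_bigr (fun k : 'I_K => (\sum_(l < n) ga k * nc (A l (l + k)%N))%:E)); last first.
  by move=> k _; exact: tE.
rewrite sumEFin; apply: le_trans (partial_pairing_le A B (n + K)); rewrite lee_fin.
rewrite exchange_big /=.
apply: le_trans (@sum_ord_le (fun j => \sum_(m < n + K) nc (A j m * B j m)) n
  _ _ (leq_addr K n)); last first.
  by move=> j; apply: sumr_ge0 => m _; exact: nc_ge0.
apply: ler_sum => l _.
apply: le_trans (@sum_ord_shift_le (fun m => nc (A l m * B l m)) l K _ _ _).
- apply: ler_sum => k _; rewrite ncM mulrC ler_wpM2l ?nc_ge0//.
  exact: gaB.
- by move=> m; exact: nc_ge0.
- by rewrite leq_add2r ltnW.
Qed.

End Pairing.

(** * Bloch matrices *)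

Section BlochSpace.
Local Open Scope ring_scope.
Local Open Scope complex_scope.
Variable R : realType.
Implicit Types (A B : imatrix R) (r c : R).
Notation nc := (@Normc.normc R).

Lemma bloch_derivE B r j m : bloch_deriv B r j m =
  if (j <= m)%N then ((m - j)%:R * r ^+ (m - j).-1)%:C * B j m else 0.
Proof.
rewrite /bloch_deriv /diag; case: leqP => jm; last first.
  rewrite big1_seq// => k _; rewrite ltn_eqF ?mulr0 ?mul0r//.
  by rewrite (leq_trans jm)// leq_addr.
have [jm0|jm0] := posnP (m - j)%N.
  rewrite jm0 mul0r mul0r big1_seq// => k; rewrite mem_index_iota => /andP[_ /andP[k0 _]].
  case: eqP => [E|]; last by rewrite mulr0 mul0r.
  lia.
rewrite (bigD1_seq (m - j)%N)/=; last 2 first.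
- by rewrite mem_index_iota jm0 ltnS leq_subr.
- exact: iota_uniq.
rewrite subnKC// eqxx big1 ?addr0 => [|k kE].
  by rewrite rmorphM rmorph_nat mulrAC.
by case: eqP => [E|]; [move: kE; rewrite E addnC addnK eqxx|rewrite mulr0 mul0r].
Qed.

(** A sufficient condition for the Bloch space, stated on finite sections. The weight 1 / (1 - r) is
    what geometric sums produce; as (1 - r^2) / (1 - r) <= 2, the Bloch norm is at most 2 c + c. *)
Definition bloch_test B c : Prop :=
  [/\ upper_triangular B, form_bound (diag B 0) c &
      forall r, 0 <= r < 1 -> form_bound (bloch_deriv B r) (c / (1 - r))].

Lemma blochnorm_le_test B c : 0 < c -> bloch_test B c ->
  (blochnorm B <= (3 * c)%:E)%E.
Proof.
move=> c0 [_ B0 Br]; rewrite (_ : 3 * c = 2 * c + c); last by ring.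
rewrite EFinD; apply: leeD; last exact: opnorm_le.
apply: ge_ereal_sup => _ [r /andP[r0 r1] <-].
have r'0 : 0 < 1 - r by rewrite subr_gt0.
have cr : 0 < c / (1 - r) by rewrite divr_gt0.
have w0 : 0 <= 1 - r ^+ 2 by rewrite subr_ge0 expr_le1// ltW.
apply: le_trans (lee_wpmul2l _ (opnorm_le cr (Br _ _))) _; rewrite ?r0//.
rewrite -EFinM lee_fin (_ : (1 - r ^+ 2) * (c / (1 - r)) = (1 + r) * c); last first.
  by field; rewrite gt_eqF.
by rewrite ler_wpM2r ?ltW//; move: r1; lra.
Qed.

Lemma bloch_test_bloch B c : 0 < c -> bloch_test B c -> bloch R B.
Proof.
move=> c0 Bc; split; first by case: Bc.
by apply: le_lt_trans (blochnorm_le_test c0 Bc) _; rewrite ltry.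
Qed.

Lemma bloch_test_scale B c (a : R) : 0 <= a -> bloch_test B c ->
  bloch_test (fun j m => a%:C * B j m) (a * c).
Proof.
move=> a0 [Bu B0 Br]; split=> [j m jm|n|r rr].
- by rewrite Bu// mulr0.
- apply: eq_form_bound (form_bound_scale a0 B0) n => j m.
  by rewrite /diag; case: ifP => //; rewrite mulr0.
- rewrite -mulrA; apply: eq_form_bound (form_bound_scale a0 (Br r rr)) => j m.
  by rewrite !bloch_derivE; case: ifP => _; rewrite ?mulr0// mulrCA.
Qed.

(** By homogeneity: [B] divided by 3 c lies in the unit ball over which [kothenorm] is a
    supremum. *)
Lemma test_pairing_le_kothenorm A B c : 0 < c -> bloch_test B c ->
  (abs_pairing A B <= (3 * c)%:E * kothenorm A)%E.
Proof.
move=> c0 Bc; have c3 : 0 < 3 * c by rewrite mulr_gt0.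
set a := (3 * c)^-1; have a0 : 0 < a by rewrite invr_gt0.
have Bac := bloch_test_scale (ltW a0) Bc.
have ac0 : 0 < a * c by rewrite mulr_gt0.
apply: abs_pairing_le => N.
have -> : partial_pairing A B N
    = (3 * c) * partial_pairing A (fun j m => a%:C * B j m) N.
  rewrite /partial_pairing !mulr_sumr; apply: eq_bigr => j _.
  rewrite mulr_sumr; apply: eq_bigr => m _.
  rewrite mulrCA [in RHS]ncM nc_real gtr0_norm// mulrA divff ?mul1r//.
  by rewrite gt_eqF.
rewrite EFinM lee_wpmul2l ?lee_fin ?(ltW c3)//.
apply: le_trans (partial_pairing_le _ _ _) _; apply: ereal_sup_ubound.
exists (fun j m => a%:C * B j m) => //; split; first exact: bloch_test_bloch Bac.
apply: le_trans (blochnorm_le_test ac0 Bac) _.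
by rewrite lee_fin mulrCA /a mulVf ?gt_eqF.
Qed.

End BlochSpace.

(** * Dyadic blocks of the rows and columns of a Bloch matrix *)

Section DyadicBlocks.
Local Open Scope ring_scope.
Local Open Scope complex_scope.
Variable R : realType.
Implicit Types (A B : imatrix R) (r c : R).
Notation nc := (@Normc.normc R).

Lemma block_start_le n : (block_start n <= 2 ^ n.+1)%N.
Proof. by case: n => // n; rewrite leq_exp2l. Qed.

Lemma sum_blocks (F : nat -> R) n :
  \sum_(0 <= k < 2 ^ n.+1) F k =
  \sum_(0 <= i < n.+1) \sum_(block_start i <= k < 2 ^ i.+1) F k.
Proof.
elim: n => [|n IH]; first by rewrite big_nat1.
by rewrite big_nat_recr//= -IH (@big_cat_nat _ _ _ (2 ^ n.+1))//= leq_exp2l.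
Qed.

Lemma sum_le_blocks (F : nat -> R) N : (forall k, 0 <= F k) ->
  \sum_(k < N) F k <=
  \sum_(0 <= i < N.+1) \sum_(block_start i <= k < 2 ^ i.+1) F k.
Proof.
move=> F0; rewrite -sum_blocks big_mkord; apply: sum_ord_le => //.
by rewrite (leq_trans (leqnSn N))// ltnW// ltn_expl.
Qed.

Lemma cauchy_schwarz_bound (r : seq nat) (a b : nat -> R) (T : R) : 0 < T ->
    \sum_(k <- r) b k ^+ 2 <= T ^+ 2 ->
  \sum_(k <- r) a k * b k <= T * Num.sqrt (\sum_(k <- r) a k ^+ 2).
Proof.
move=> T0 bT; set s2 := \sum_(k <- r) a k ^+ 2.
have s20 : 0 <= s2 by apply: sumr_ge0 => k _; exact: sqr_ge0.
have [s0|s0] := eqVneq s2 0.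
  rewrite s0 sqrtr0 mulr0 le_eqVlt; apply/orP; left; apply/eqP.
  move/eqP: s0; rewrite /s2 psumr_eq0 => [/allP s0|k _]; last exact: sqr_ge0.
  by apply: big1_seq => k /andP[_ /s0]; rewrite sqrf_eq0 => /eqP ->; rewrite mul0r.
set s := Num.sqrt s2.
have s_gt0 : 0 < s by rewrite sqrtr_gt0 lt_neqAle eq_sym s0.
have sE : s ^+ 2 = s2 by rewrite sqr_sqrtr.
have st : 0 < 2 * s * T by rewrite !mulr_gt0.
(* After multiplication by 2 s T, each product obeys 2 s T a b <= T^2 a^2 + s^2 b^2, and each half
   sums to at most s^2 T^2. *)
rewrite -(ler_pM2l st).
apply: (@le_trans _ _ (\sum_(k <- r) (T ^+ 2 * a k ^+ 2 + s ^+ 2 * b k ^+ 2))).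
  rewrite mulr_sumr; apply: ler_sum => k _.
  by have := sqr_ge0 (T * a k - s * b k); nra.
rewrite big_split /= -!mulr_sumr -/s2 -sE.
have : s ^+ 2 * \sum_(k <- r) b k ^+ 2 <= s ^+ 2 * T ^+ 2.
  by rewrite ler_wpM2l ?sqr_ge0.
by lra.
Qed.

Lemma ell21_partial_le (a : nat -> R[i]) N :
  ((\sum_(0 <= i < N) Num.sqrt (\sum_(block_start i <= k < 2 ^ i.+1) nc (a k) ^+ 2))%:E
    <= ell21 (@cabs R \o a))%E.
Proof.
rewrite -sumEFin; apply: le_trans (nneseries_lim_ge N _) => [|i _ _]; last first.
  exact: sqrte_ge0.
apply: lee_sum => i _.
rewrite -[X in (X <= _)%E]/(sqrte (\sum_(block_start i <= k < 2 ^ i.+1) nc (a k) ^+ 2)%:E).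
by rewrite -sumEFin; under eq_bigr => k _ do rewrite EFin_expe.
Qed.

(** Duality of l(2,1) with the sequences whose l_2 norms on the blocks are uniformly bounded, by
    Cauchy-Schwarz on each block. *)
Lemma ell21_pairing (a b : nat -> R[i]) (T : R) N : 0 < T ->
    (forall n, \sum_(block_start n <= k < 2 ^ n.+1) nc (b k) ^+ 2 <= T ^+ 2) ->
  ((\sum_(k < N) nc (a k) * nc (b k))%:E <= T%:E * ell21 (@cabs R \o a))%E.
Proof.
move=> T0 bT.
apply: le_trans (lee_wpmul2l _ (ell21_partial_le a N.+1)); last by rewrite lee_fin ltW.
rewrite -EFinM lee_fin mulr_sumr.
apply: le_trans (@sum_le_blocks (fun k => nc (a k) * nc (b k)) _ _) _.
  by move=> k; rewrite mulr_ge0 ?nc_ge0.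
by apply: ler_sum => i _; exact: (@cauchy_schwarz_bound _ (nc \o a) (nc \o b)).
Qed.

Lemma bernoulli_ge (x : R) n : 0 <= x <= 1 -> 1 - n%:R * x <= (1 - x) ^+ n.
Proof.
move=> /andP[x0 x1]; elim: n => [|n IH]; first by rewrite mul0r subr0 expr0.
rewrite exprS; apply: (@le_trans _ _ ((1 - x) * (1 - n%:R * x))); last first.
  by rewrite ler_wpM2l// subr_ge0.
have : 0 <= n%:R * (x * x) by rewrite !mulr_ge0.
by rewrite -[n.+1%:R]natr1; nra.
Qed.

(** With x = 2^-(n+1) and r = 1 - x: 1 - r^2 >= x, k x >= 1/2, and r^(k-1) >= (r^(2^n))^2 >= 1/4 by
    Bernoulli's inequality. *)
Lemma bloch_weight_ge n k : (2 ^ n <= k < 2 ^ n.+1)%N ->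
  8^-1 <= (1 - (1 - (2 ^+ n.+1)^-1) ^+ 2) *
          (k%:R * (1 - (2 ^+ n.+1)^-1) ^+ k.-1) :> R.
Proof.
case/andP=> nk kn; set x : R := (2 ^+ n.+1)^-1; set r := 1 - x.
have p0 : (0 : R) < 2 ^+ n.+1 by rewrite exprn_gt0.
have x0 : 0 < x by rewrite invr_gt0.
have x1 : x <= 1 by rewrite invf_le1// exprn_ege1// ler1n.
have r0 : 0 <= r by rewrite subr_ge0.
have r1 : r <= 1 by rewrite gerBl ltW.
have hx : (2 ^ n)%N%:R * x = 2^-1.
  by rewrite /x natrX exprS invfM mulrCA divff ?mulr1// gt_eqF// exprn_gt0.
have rh : 2^-1 <= r ^+ (2 ^ n).
  apply: le_trans (bernoulli_ge _ _); last by rewrite ltW.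
  by rewrite hx; lra.
have rk : 4^-1 <= r ^+ k.-1.
  apply: (@le_trans _ _ (r ^+ (2 ^ n.+1))).
    by rewrite expnSr exprM; nra.
  by apply: ler_wiXn2l => //; rewrite (leq_trans (leq_pred k))// ltnW.
have w : x <= 1 - r ^+ 2 by rewrite /r; nra.
have kk : 2^-1 <= k%:R * x.
  by rewrite -hx ler_wpM2r ?(ltW x0)// ler_nat.
have k0 : (0 : R) <= k%:R by [].
apply: (@le_trans _ _ (x * (k%:R * r ^+ k.-1))).
  by rewrite mulrCA mulrA; nra.
by rewrite ler_wpM2r// mulr_ge0// exprn_ge0.
Qed.

(* [b] stands for the moduli along a row or a column of a Bloch matrix. *)
Lemma bloch_block_bound (b : nat -> R) (M : R) : 0 <= M -> (0 <= b 0%N <= M) ->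
    (forall r n, 0 <= r < 1 ->
      (1 - r ^+ 2) ^+ 2 * \sum_(k < n) (k%:R * r ^+ k.-1 * b k) ^+ 2 <= M ^+ 2) ->
  forall n, \sum_(block_start n <= k < 2 ^ n.+1) b k ^+ 2 <= (9 * M) ^+ 2.
Proof.
move=> M0 /andP[b00 b0M] H.
have main n : \sum_(2 ^ n <= k < 2 ^ n.+1) b k ^+ 2 <= 64 * M ^+ 2.
  set r : R := 1 - (2 ^+ n.+1)^-1.
  have p1 : (1 : R) <= 2 ^+ n.+1 by rewrite exprn_ege1// ler1n.
  have rr : 0 <= r < 1.
    rewrite subr_ge0 invf_le1 ?(lt_le_trans ltr01)// p1 /=.
    by rewrite gtrBl invr_gt0 (lt_le_trans ltr01).
  apply: le_trans (ler_wpM2l _ (H r (2 ^ n.+1)%N rr)) => //.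
  rewrite mulrA mulr_sumr -(big_mkord xpredT (fun k =>
    64 * (1 - r ^+ 2) ^+ 2 * (k%:R * r ^+ k.-1 * b k) ^+ 2)).
  rewrite [leRHS](@big_cat_nat _ _ _ (2 ^ n))//= ?leq_exp2l//.
  rewrite ler_wpDl ?sumr_ge0// => [k _|].
    by rewrite mulr_ge0 ?sqr_ge0// mulr_ge0 ?sqr_ge0.
  rewrite big_nat [leRHS]big_nat; apply: ler_sum => k kn.
  have w := bloch_weight_ge kn; rewrite -/r in w.
  rewrite (_ : _ * _ * _ = (8 * ((1 - r ^+ 2) * (k%:R * r ^+ k.-1))) ^+ 2 * b k ^+ 2).
    rewrite ler_peMl ?sqr_ge0// exprn_ege1//.
    by move: w; set y := _ * _; lra.
  by rewrite -/(GRing.exp _ _); ring.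
(* The zeroth block contains k = 0 besides k = 1; the constant 9 comes from 1 + 64 <= 81. *)
case=> [|n]; last by apply: le_trans (main _) _; have := sqr_ge0 M; nra.
have := main 0%N; rewrite expn1 expn0 big_nat1 => h.
rewrite big_nat_recr//= big_nat1.
have : b 0%N ^+ 2 <= M ^+ 2 by rewrite lerXn2r.
by have := sqr_ge0 M; lra.
Qed.

Section BlochRowsColumns.
Variables (B : imatrix R) (M : R).
Hypotheses (M0 : 0 <= M) (BM : (blochnorm B <= M%:E)%E).

Lemma opnorm_ge0 (C : imatrix R) : (0 <= opnorm C)%E.
Proof. by have := row_le_opnorm C 0 0; rewrite big_ord0 sqrtr0. Qed.

Lemma bloch_parts : (forall r, 0 <= r < 1 ->
    ((1 - r ^+ 2)%:E * opnorm (bloch_deriv B r) <= M%:E)%E) /\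
  (opnorm (diag B 0) <= M%:E)%E.
Proof.
have le_sup r : 0 <= r < 1 -> ((1 - r ^+ 2)%:E * opnorm (bloch_deriv B r) <=
    ereal_sup [set ((1 - r ^+ 2)%:E * opnorm (bloch_deriv B r))%E
            | r in [set r : R | (0 <= r < 1)%R]])%E.
  by move=> rr; apply: ereal_sup_ubound; exists r.
split=> [r rr|].
  apply: le_trans (le_sup _ rr) _; apply: le_trans BM.
  by rewrite leeDl// opnorm_ge0.
apply: le_trans BM; rewrite leeDr//; apply: le_trans (le_sup 0 _).
  by rewrite expr0n subr0 mul1e opnorm_ge0.
by rewrite lexx ltr01.
Qed.

Let sqr_opnorm_bound r (s : R) : 0 <= r < 1 -> 0 <= s ->
  ((Num.sqrt s)%:E <= opnorm (bloch_deriv B r))%E ->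
  (1 - r ^+ 2) ^+ 2 * s <= M ^+ 2.
Proof.
move=> rr s0 sr; have /andP[r0 r1] := rr.
have w0 : 0 <= 1 - r ^+ 2 by rewrite subr_ge0 expr_le1// ltW.
have : ((1 - r ^+ 2)%:E * (Num.sqrt s)%:E <= M%:E)%E.
  by apply: le_trans (bloch_parts.1 r rr); rewrite lee_wpmul2l ?lee_fin.
rewrite -EFinM lee_fin => h.
by rewrite -{1}(sqr_sqrtr s0) -exprMn lerXn2r ?nnegrE// mulr_ge0 ?sqrtr_ge0.
Qed.

Lemma bloch_row_block j n :
  \sum_(block_start n <= k < 2 ^ n.+1) nc (rowseq B j k) ^+ 2 <= (9 * M) ^+ 2.
Proof.
apply: (@bloch_block_bound (fun k => nc (rowseq B j k))) => // [|r K rr].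
  rewrite nc_ge0 /rowseq addn0 -lee_fin; apply: le_trans bloch_parts.2.
  apply: le_trans (row_le_opnorm _ j.+1 j).
  rewrite lee_fin -[leLHS]ger0_norm ?nc_ge0// -sqrtr_sqr ler_wsqrtr//.
  rewrite big_ord_recr /= /diag addn0 eqxx lerDr.
  by apply: sumr_ge0 => k _; exact: sqr_ge0.
apply: sqr_opnorm_bound => //; first by apply: sumr_ge0 => k _; exact: sqr_ge0.
apply: le_trans (row_le_opnorm _ (j + K) j); rewrite lee_fin ler_wsqrtr//.
apply: le_trans (@sum_ord_shift_le _ (fun m => nc (bloch_deriv B r j m) ^+ 2) j K _ _ _).
- apply: ler_sum => k _; rewrite bloch_derivE leq_addr addKn ncM nc_real.
  by have /andP[r0 _] := rr; rewrite ger0_norm// mulr_ge0// exprn_ge0.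
- by move=> m; exact: sqr_ge0.
- by [].
Qed.

Lemma bloch_col_block m n :
  \sum_(block_start n <= k < 2 ^ n.+1) nc (colseq B m k) ^+ 2 <= (9 * M) ^+ 2.
Proof.
apply: (@bloch_block_bound (fun k => nc (colseq B m k))) => // [|r K rr].
  rewrite nc_ge0 /colseq subn0 -lee_fin; apply: le_trans bloch_parts.2.
  apply: le_trans (row_le_opnorm _ m.+1 m).
  rewrite lee_fin -[leLHS]ger0_norm ?nc_ge0// -sqrtr_sqr ler_wsqrtr//.
  rewrite big_ord_recr /= /diag addn0 eqxx lerDr.
  by apply: sumr_ge0 => k _; exact: sqr_ge0.
apply: sqr_opnorm_bound => //; first by apply: sumr_ge0 => k _; exact: sqr_ge0.
apply: le_trans (col_le_opnorm _ m.+1 m); rewrite lee_fin ler_wsqrtr//.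
(* Down column m the diagonal index m - j decreases, so the sum is reversed to run over k. *)
rewrite [leRHS](reindex_inj rev_ord_inj) /=.
pose f k := (k%:R * r ^+ k.-1 * nc (colseq B m k)) ^+ 2.
apply: (@le_trans _ _ (\sum_(k < K + m.+1) f k)).
  by apply: sum_ord_le => [k|]; rewrite ?sqr_ge0// leq_addr.
rewrite -[leRHS](sum_trunc (fun k => nc (bloch_deriv B r (m.+1 - k.+1)%N m) ^+ 2) (leq_addl K _)).
apply: ler_sum => k _; rewrite /f /colseq ltnS; case: leqP => km; last first.
  by rewrite Normc.normc0 mulr0 expr0n.
rewrite bloch_derivE subSS leq_subr subKn// ncM nc_real.
by have /andP[r0 _] := rr; rewrite ger0_norm// mulr_ge0// exprn_ge0.
Qed.

End BlochRowsColumns.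

Lemma row_pairing_le A B M : 0 < M -> upper_triangular A ->
  (blochnorm B <= M%:E)%E -> (abs_pairing A B <= (9 * M)%:E * rownorm A)%E.
Proof.
move=> M0 Au BM; apply: abs_pairing_le => N.
have M9 : 0 < 9 * M by rewrite mulr_gt0.
apply: (@le_trans _ _ ((9 * M)%:E * \sum_(0 <= j < N) ell21 (@cabs R \o rowseq A j))%E).
  rewrite big_mkord ge0_sume_distrr => [|j _]; last first.
    by apply: nneseries_ge0 => n _ _; exact: sqrte_ge0.
  rewrite -sumEFin; apply: lee_sum => j _.
  apply: le_trans (ell21_pairing (rowseq A j) N M9 (bloch_row_block (ltW M0) BM j)).
  rewrite lee_fin.
  apply: (@le_trans _ _ (\sum_(m < j + N) nc (A j m * B j m))).
    apply: (@sum_ord_le _ (fun m => nc (A j m * B j m))); rewrite ?leq_addl//.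
    by move=> m; exact: nc_ge0.
  rewrite big_split_ord /= big1 ?add0r => [|m _]; last by rewrite Au// mul0r Normc.normc0.
  by apply: ler_sum => k _; rewrite ncM.
apply: lee_wpmul2l; first by rewrite lee_fin ltW.
apply: nneseries_lim_ge => j _ _; apply: nneseries_ge0 => n _ _; exact: sqrte_ge0.
Qed.

Lemma col_pairing_le A B M : 0 < M -> upper_triangular A ->
  (blochnorm B <= M%:E)%E -> (abs_pairing A B <= (9 * M)%:E * colnorm A)%E.
Proof.
move=> M0 Au BM; apply: abs_pairing_le => N.
have M9 : 0 < 9 * M by rewrite mulr_gt0.
apply: (@le_trans _ _ ((9 * M)%:E * \sum_(0 <= m < N) ell21 (@cabs R \o colseq A m))%E).
  rewrite big_mkord ge0_sume_distrr => [|j _]; last first.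
    by apply: nneseries_ge0 => n _ _; exact: sqrte_ge0.
  rewrite /partial_pairing exchange_big -sumEFin; apply: lee_sum => m _.
  apply: le_trans (ell21_pairing (colseq A m) m.+1 M9 (bloch_col_block (ltW M0) BM m)).
  rewrite lee_fin [leRHS](reindex_inj rev_ord_inj) /=.
  rewrite -[leRHS](sum_trunc (fun k => nc (colseq A m (m.+1 - k.+1)%N) *
    nc (colseq B m (m.+1 - k.+1)%N)) (ltn_ord m)).
  apply: ler_sum => j _; rewrite ltnS subSS; case: leqP => jm; last first.
    by rewrite Au// mul0r Normc.normc0.
  by rewrite /colseq leq_subr subKn// ncM.
apply: lee_wpmul2l; first by rewrite lee_fin ltW.
apply: nneseries_lim_ge => j _ _; apply: nneseries_ge0 => n _ _; exact: sqrte_ge0.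
Qed.

End DyadicBlocks.

(** * Test matrices *)

Section BlockMatrices.
Local Open Scope ring_scope.
Local Open Scope complex_scope.
Variable R : realType.
Implicit Types (r : R) (x y : nat -> R[i]).
Notation nc := (@Normc.normc R).

Lemma eq_modn_window P N a b : (P <= a < P + N)%N -> (P <= b < P + N)%N ->
  a = b %[mod N] -> a = b.
Proof.
wlog ab : a b / (a <= b)%N => [hw ha hb E|].
  have [ab|/ltnW ba] := leqP a b; first exact: hw.
  exact/esym/(hw b a).
move=> /andP[Pa aN] /andP[Pb bN] /esym/eqP; rewrite eqn_mod_dvd// => Nd.
have [|d0] := posnP (b - a)%N; first lia.
by have := dvdn_leq d0 Nd; lia.
Qed.

Section Circulant.
Variables (N : nat) (w : R[i]).
Hypothesis N_gt0 : (0 < N)%N.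
Hypothesis w_prim : N.-primitive_root w.

(** With X and Y the transforms of x and conj y, the form is the mean over Z/N of h conj(Y) X; then
    |h| <= 1 and Parseval conclude. The ordering of the supports makes the truncated difference m -
    j exact. *)
Lemma circulant_form_bound (h : nat -> R[i]) n x y :
    (forall t, nc (h t) <= 1) ->
    (forall j m, y j != 0 -> x m != 0 -> (j <= m)%N) ->
    (forall m k, x m != 0 -> x k != 0 -> m = k %[mod N] -> m = k) ->
    (forall m k, y m != 0 -> y k != 0 -> m = k %[mod N] -> m = k) ->
  2 * nc (\sum_(j < n) \sum_(m < n) y j * fourier_coef N w h (m - j) * x m)
    <= \sum_(m < n) nc (x m) ^+ 2 + \sum_(m < n) nc (y m) ^+ 2.
Proof.
move=> h1 yx xinj yinj.
pose X t := \sum_(m < n) x m * w ^+ (m * t).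
pose Y t := \sum_(j < n) (y j)^* * w ^+ (j * t).
have NR : (0 : R) < N%:R by rewrite ltr0n.
have -> : \sum_(j < n) \sum_(m < n) y j * fourier_coef N w h (m - j) * x m
    = (N%:R^-1)%:C * \sum_(t < N) h t * (Y t)^* * X t.
  rewrite mulr_sumr.
  under [RHS]eq_bigr => t _.
    rewrite /Y /X rmorph_sum -!mulrA big_distrlr /= !mulr_sumr.
    under eq_bigr => j _ do rewrite !mulr_sumr.
    over.
  rewrite [RHS]exchange_big /=; apply: eq_bigr => j _.
  rewrite [RHS]exchange_big /=; apply: eq_bigr => m _.
  have [->|y0] := eqVneq (y j) 0.
    rewrite !mul0r big1// => t _.
    by rewrite rmorphM rmorph0 rmorph0 !mul0r !mulr0.
  have [->|x0] := eqVneq (x m) 0.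
    by rewrite mulr0 big1// => t _; rewrite mul0r !mulr0.
  rewrite /fourier_coef mulr_sumr mulr_sumr mulr_suml; apply: eq_bigr => t _.
  have jm := yx _ _ y0 x0.
  have -> : w ^+ (m * t) = w ^+ ((m - j) * t) * w ^+ (j * t).
    by rewrite -exprD -mulnDl subnK.
  have cE : ((y j)^* * w ^+ (j * t))^* = y j * (w ^+ (j * t))^*.
    by rewrite rmorphM /= conjcK.
  rewrite [X in _ = _ * (_ * (X * _))]cE.
  transitivity (y j * ((N%:R^-1)%:C * (h t * w ^+ ((m - j) * t))) * x m *
    (w ^+ (j * t) * (w ^+ (j * t))^*)); last by ring.
  by rewrite (mul_prim_root_conj N_gt0 w_prim) mulr1.
rewrite ncM nc_real ger0_norm ?invr_ge0 ?ler0n//.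
have XE := parseval N_gt0 w_prim (fun m k _ _ => @xinj m k).
have YE : \sum_(t < N) nc (Y t) ^+ 2 = N%:R * \sum_(m < n) nc (y m) ^+ 2.
  rewrite (@parseval _ _ _ N_gt0 w_prim n (fun j => (y j)^*)); last first.
    by move=> m k _ _; rewrite !conjc_eq0; exact: yinj.
  by congr (_ * _); apply: eq_bigr => m _; rewrite nc_conj.
rewrite -(ler_pM2l NR) mulrCA !mulrA mulfK ?gt_eqF//.
rewrite mulrDr -(XE n) -YE -big_split /=.
apply: le_trans (ler_wpM2l _ (nc_sum _ _ _)) _ => //.
rewrite mulr_sumr; apply: ler_sum => t _.
rewrite !ncM nc_conj; apply: le_trans (ncM_le _ _).
rewrite ler_wpM2l// mulrC ler_wpM2l ?nc_ge0//.
by rewrite ler_piMl ?nc_ge0.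
Qed.

End Circulant.

(* The band [2^(s+2) <= m - j < 2^(s+3)] is covered by rectangles of
   [2^s] rows and [5 * 2^s] columns; a column meets at most five of them. *)
Definition block_mx (s : nat) (g : nat -> R[i]) : imatrix R := fun j m =>
  if (j %/ 2 ^ s * 2 ^ s + 4 * 2 ^ s <= m < j %/ 2 ^ s * 2 ^ s + 9 * 2 ^ s)%N
  then g (m - j)%N else 0.

Lemma divn_window q j : (0 < q)%N -> (j %/ q * q <= j < j %/ q * q + q)%N.
Proof. by move=> q0; rewrite {2 3}(divn_eq j q) leq_addr ltn_add2l ltn_mod. Qed.

Lemma block_mx_band s g j m : block_mx s g j m != 0 ->
  (j + 3 * 2 ^ s < m < j + 9 * 2 ^ s)%N.
Proof.
rewrite /block_mx; case: ifP; last by rewrite eqxx.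
have q0 : (0 < 2 ^ s)%N by rewrite expn_gt0.
have := divn_window j q0; set P := (_ * _)%N; set q := (2 ^ s)%N.
lia.
Qed.

Lemma block_mx_in_band s g j k : (4 * 2 ^ s <= k < 8 * 2 ^ s)%N ->
  block_mx s g j (j + k) = g k.
Proof.
rewrite /block_mx addKn.
have q0 : (0 < 2 ^ s)%N by rewrite expn_gt0.
have := divn_window j q0; set P := (_ * _)%N; set q := (2 ^ s)%N.
by case: ifP => //; lia.
Qed.

Lemma sum_window_le n a : (\sum_(p < n) (a <= p < a + 5) <= 5)%N.
Proof.
suff -> : (\sum_(p < n) (a <= p < a + 5) = minn (n - a) 5)%N by exact: geq_minr.
elim: n => [|n IH]; first by rewrite big_ord0.
rewrite big_ord_recr /= IH.
by case: (boolP (a <= n < a + 5)%N) => /= h; lia.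
Qed.

Section BlockForm.
Variables (s : nat) (w : R[i]).
Let q := (2 ^ s)%N.
(** Large enough for the 9 q indices around a rectangle to be distinct mod N, and for the offsets of
    the band, below 8 q, to be frequencies less than N. *)
Let N := (16 * q)%N.
Hypothesis w_prim : N.-primitive_root w.
Variable (h : nat -> R[i]).
Hypothesis h1 : forall t, nc (h t) <= 1.
Let g := fourier_coef N w h.

Let q_gt0 : (0 < q)%N. Proof. by rewrite expn_gt0. Qed.
Let N_gt0 : (0 < N)%N. Proof. by rewrite muln_gt0. Qed.

(* Inside the rectangle, [r^(m-j-1)] and [m - j] split into factors depending
   on [j] and on [m] only. *)
Let rectangle_bound r n x y P : 0 <= r < 1 ->
    (forall j, y j != 0 -> (P <= j < P + q)%N) ->
    (forall m, x m != 0 -> (P + 4 * q <= m < P + 9 * q)%N) ->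
  2 * nc (\sum_(j < n) \sum_(m < n)
      y j * (((m - j)%:R * r ^+ (m - j).-1)%:C * g (m - j)) * x m)
    <= 18 * (q%:R * r ^+ q) *
       (\sum_(m < n) nc (x m) ^+ 2 + \sum_(m < n) nc (y m) ^+ 2).
Proof.
move=> /andP[r0 r1] ysupp xsupp.
have Q0 : (0 : R) < 9 * q%:R by rewrite mulr_gt0// ltr0n.
(* On the supports, m - j - 1 = (2 q - 1) + (P + q - j) + (m - P - 3 q) with nonnegative summands,
   and [la m - la j] is (m - j) / (9 q). There [al], [be] and [la] take values in [0, 1]. *)
pose al j := r ^+ (P + q - j).
pose be m := r ^+ (m - (P + 3 * q)).
pose la m : R := (m - P)%:R / (9 * q%:R).
pose y1 j := (al j)%:C * y j.
pose y2 j := (al j * la j)%:C * y j.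
pose x1 m := (be m * la m)%:C * x m.
pose x2 m := (be m)%:C * x m.
have z0 (a : R) (z : R[i]) : a%:C * z != 0 -> z != 0.
  by apply: contraNneq => ->; rewrite mulr0.
have splitE j m : y j * (((m - j)%:R * r ^+ (m - j).-1)%:C * g (m - j)) * x m
   = (9 * q%:R * r ^+ (2 * q).-1)%:C *
     (y1 j * g (m - j) * x1 m - y2 j * g (m - j) * x2 m).
  have [yj|y0] := eqVneq (y j) 0.
    by rewrite /y1 /y2 yj !(mul0r, mulr0, subrr).
  have [xm|x0] := eqVneq (x m) 0.
    by rewrite /x1 /x2 xm !(mulr0, subrr).
  have /andP[Pj jP] := ysupp _ y0; have /andP[Pm mP] := xsupp _ x0.
  have -> : (m - j).-1 = ((2 * q).-1 + (P + q - j) + (m - (P + 3 * q)))%N by lia.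
  have -> : (m - j)%:R = 9 * q%:R * (la m - la j) :> R.
    rewrite /la -mulrBl mulrC mulfVK ?gt_eqF//.
    rewrite -natrB; last by lia.
    by congr _%:R; lia.
  rewrite /y1 /y2 /x1 /x2 -/(al j) !exprD -/(al j) -/(be m).
  move: (al j) (be m) (la m) (la j) (r ^+ _) (9 * q%:R : R) => a b u v c d.
  rewrite (_ : (d * (u - v) * (c * a * b))%:C
    = d%:C * (u%:C - v%:C) * (c%:C * a%:C * b%:C)); last first.
    by rewrite !rmorphM rmorphB.
  have CM (e f : R) : (e * f)%:C = e%:C * f%:C by rewrite rmorphM.
  by rewrite (CM d c) (CM b u) (CM a v); ring.
under eq_bigr => j _ do under eq_bigr => m _ do rewrite splitE.
have -> : \sum_(j < n) \sum_(m < n) (9 * q%:R * r ^+ (2 * q).-1)%:C *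
     (y1 j * g (m - j) * x1 m - y2 j * g (m - j) * x2 m)
  = (9 * q%:R * r ^+ (2 * q).-1)%:C *
    (\sum_(j < n) \sum_(m < n) y1 j * g (m - j) * x1 m
     - \sum_(j < n) \sum_(m < n) y2 j * g (m - j) * x2 m).
  rewrite -sumrB mulr_sumr; apply: eq_bigr => j _.
  by rewrite -sumrB mulr_sumr.
set S1 := \sum_(j < n) \sum_(m < n) _; set S2 := \sum_(j < n) \sum_(m < n) y2 j * _ * _.
set X := \sum_(m < n) nc (x m) ^+ 2; set Y := \sum_(m < n) nc (y m) ^+ 2.
have XY0 : 0 <= X + Y by rewrite addr_ge0// sum_nc_sqr_ge0.
have shrink (a : nat -> R) (z : nat -> R[i]) :
    (forall m, z m != 0 -> 0 <= a m <= 1) ->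
  \sum_(m < n) nc ((a m)%:C * z m) ^+ 2 <= \sum_(m < n) nc (z m) ^+ 2.
  move=> a01; apply: ler_sum => m _; apply: le_nc_sqr2; rewrite ncM nc_real.
  have [->|/a01/andP[a0 a1]] := eqVneq (z m) 0; first by rewrite Normc.normc0 mulr0.
  by rewrite ger0_norm// ler_piMl ?nc_ge0.
have pw k : 0 <= r ^+ k <= 1 by rewrite exprn_ge0// exprn_ile1// ltW.
have la01 m : (P <= m < P + 9 * q)%N -> 0 <= la m <= 1.
  move=> Pm; rewrite divr_ge0 ?(ltW Q0)//= ler_pdivrMr// mul1r -natrM ler_nat; lia.
have mul01 (a b : R) : 0 <= a <= 1 -> 0 <= b <= 1 -> 0 <= a * b <= 1.
  by move=> /andP[a0 a1] /andP[b0 b1]; rewrite mulr_ge0//= mulr_ile1.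
have xw m : x m != 0 -> (P <= m < P + 9 * q)%N by move/xsupp; lia.
have yw m : y m != 0 -> (P <= m < P + 9 * q)%N by move/ysupp; lia.
have inj z : (forall m, z m != 0 -> (P <= m < P + 9 * q)%N) ->
    forall m k, z m != 0 -> z k != 0 -> m = k %[mod N] -> m = k.
  move=> zw m k /zw mw /zw kw; apply: (@eq_modn_window P N); rewrite /N; lia.
have yx j m : y j != 0 -> x m != 0 -> (j <= m)%N.
  by move=> /ysupp jw /xsupp mw; lia.
have b1 : 2 * nc S1 <= X + Y.
  apply: le_trans (circulant_form_bound N_gt0 w_prim n h1 _ _ _) _.
  - by move=> j m /z0 yj /z0 xm; exact: yx.
  - by apply: inj => m /z0/xw.
  - by apply: inj => m /z0/yw.
  apply: lerD; [apply: (shrink (fun m => be m * la m))|apply: (shrink al)].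
    by move=> m /xw/la01; apply: mul01; exact: pw.
  by move=> m _; exact: pw.
have b2 : 2 * nc S2 <= X + Y.
  apply: le_trans (circulant_form_bound N_gt0 w_prim n h1 _ _ _) _.
  - by move=> j m /z0 yj /z0 xm; exact: yx.
  - by apply: inj => m /z0/xw.
  - by apply: inj => m /z0/yw.
  apply: lerD; [apply: (shrink be)|apply: (shrink (fun m => al m * la m))].
    by move=> m _; exact: pw.
  by move=> m /yw/la01; apply: mul01; exact: pw.
have d : 2 * nc (S1 - S2) <= 2 * (X + Y).
  have := ncD S1 (- S2); rewrite normcN; lra.
have /andP[p0 _] := pw (2 * q).-1.
have c0 : 0 <= 9 * q%:R * r ^+ (2 * q).-1 by rewrite mulr_ge0// ltW.
rewrite ncM nc_real ger0_norm// mulrCA.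
apply: le_trans (ler_wpM2l c0 d) _.
(* As q >= 1, the exponent 2 q - 1 is at least q; the two products and the factor 9 q make the
   constant 18. *)
have le_r : r ^+ (2 * q).-1 <= r ^+ q.
  apply: ler_wiXn2l; [exact: r0|exact: ltW|].
  by move: q_gt0; clear; lia.
rewrite [leLHS]mulrA; apply: ler_wpM2r => //.
rewrite (_ : 18 * _ = 9 * q%:R * r ^+ q * 2); last by ring.
by rewrite ler_wpM2r// ler_wpM2l// ltW.
Qed.

(** The form is split over the rectangles: their row sets are disjoint and each column lies in at
    most five of them, so the bounds add up to 18 * 5 = 90 whatever the number of rectangles. *)
Lemma block_form_bound r : 0 <= r < 1 ->
  form_bound (bloch_deriv (block_mx s g) r) (90 * (q%:R * r ^+ q)).
Proof.
move=> rr n x y.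
pose yp p j := if (j %/ q == p)%N then y j else 0.
pose xp p m := if (p * q + 4 * q <= m < p * q + 9 * q)%N then x m else 0.
have -> : \sum_(j < n) \sum_(m < n) y j * bloch_deriv (block_mx s g) r j m * x m
  = \sum_(p < n) \sum_(j < n) \sum_(m < n)
      yp p j * (((m - j)%:R * r ^+ (m - j).-1)%:C * g (m - j)) * xp p m.
  rewrite [RHS]exchange_big; apply: eq_bigr => j _.
  have jn : (j %/ q < n)%N by rewrite (leq_ltn_trans (leq_div _ _)).
  rewrite [RHS](bigD1 (Ordinal jn))//= [X in _ = _ + X]big1 ?addr0; last first.
    move=> p pj; rewrite big1// => m _; rewrite /yp ifF ?mul0r//.
    by apply/negbTE; move: pj; rewrite -val_eqE eq_sym.
  apply: eq_bigr => m _; rewrite /yp eqxx bloch_derivE /xp /block_mx -/q.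
  have := divn_window j q_gt0; set P := (_ * _)%N => Pj.
  case: ifP => [_|jm]; case: ifP => [win|_]; rewrite ?(mulr0, mul0r)//.
  lia.
have r0 : 0 <= q%:R * r ^+ q by have /andP[? _] := rr; rewrite mulr_ge0// exprn_ge0.
apply: le_trans (ler_wpM2l _ (nc_sum _ _ _)) _ => //.
rewrite mulr_sumr; apply: (@le_trans _ _ (\sum_(p < n) 18 * (q%:R * r ^+ q) *
    (\sum_(m < n) nc (xp p m) ^+ 2 + \sum_(m < n) nc (yp p m) ^+ 2))).
  apply: ler_sum => p _; apply: (@rectangle_bound r n _ _ (p * q)%N) => // [j|m].
    rewrite /yp; have [<- _|] := eqVneq (j %/ q)%N p; last by rewrite eqxx.
    exact: divn_window.
  by rewrite /xp; case: ifP => // _; rewrite eqxx.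
rewrite -mulr_sumr (_ : 90 * _ = 18 * (q%:R * r ^+ q) * 5); last by ring.
rewrite -[leRHS]mulrA; apply: ler_wpM2l; first by rewrite mulr_ge0.
rewrite big_split /= mulrDr; apply: lerD.
  rewrite exchange_big mulr_sumr /=; apply: ler_sum => m _.
  (* Column m meets rectangle p when p + 4 <= m / q < p + 9, which confines p to five consecutive
     values from m / q - 8 on. *)
  apply: (@le_trans _ _ (\sum_(p < n)
      ((m %/ q - 8 <= p < m %/ q - 8 + 5)%N)%:R * nc (x m) ^+ 2)).
    apply: ler_sum => p _; rewrite /xp; case: ifP => win; last first.
      by rewrite Normc.normc0 expr0n mulr_ge0// sqr_ge0.
    rewrite (_ : (_ <= _ < _)%N = true) ?mul1r//.
    have : (p + 4 <= m %/ q < p + 9)%N.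
      by rewrite leq_divRL// ltn_divLR// !mulnDl.
    by clear; lia.
  rewrite -mulr_suml ler_wpM2r ?sqr_ge0// -natr_sum (ler_nat _ _ 5).
  exact: sum_window_le.
rewrite exchange_big mulr_sumr /=; apply: ler_sum => j _.
have jn : (j %/ q < n)%N by rewrite (leq_ltn_trans (leq_div _ _)).
rewrite (bigD1 (Ordinal jn))//= [X in _ + X]big1 ?addr0; last first.
  move=> p pj; rewrite /yp ifF ?Normc.normc0 ?expr0n//.
  by apply/negbTE; move: pj; rewrite -val_eqE eq_sym.
by rewrite /yp eqxx ler_peMl ?sqr_ge0// ler1n.
Qed.

End BlockForm.

End BlockMatrices.

(** * Matchings, and sums of blocks with large diagonals *)

Section TestMatrices.
Local Open Scope ring_scope.
Local Open Scope complex_scope.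
Variable R : realType.
Implicit Types (A B : imatrix R) (r c : R) (al : nat -> R).
Notation nc := (@Normc.normc R).

Lemma geometric_sum_le r n : 0 <= r < 1 -> \sum_(k < n) r ^+ k <= (1 - r)^-1.
Proof.
move=> /andP[r0 r1]; have d : 0 < 1 - r by rewrite subr_gt0.
rewrite -(ler_pM2l d) divff ?gt_eqF//.
have := subrX1 r n; have := exprn_ge0 n r0; nra.
Qed.

(** Each of the k powers r^0, ..., r^(k-1) is at least r^(k-1). *)
Lemma natX_le_geometric r k : 0 <= r < 1 -> k%:R * r ^+ k.-1 <= (1 - r)^-1.
Proof.
move=> rr; apply: le_trans (geometric_sum_le k rr).
have /andP[r0 r1] := rr.
rewrite mulr_natl -[k in _ *+ k]card_ord -sumr_const; apply: ler_sum => i _.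
apply: ler_wiXn2l; [exact: r0|exact: ltW|have := ltn_ord i; lia].
Qed.

(** Cauchy condensation: for s >= 1, 2^s r^(2^s) is at most twice the sum of r^k over 2^(s-1) < k <=
    2^s, and these ranges are disjoint. *)
Lemma sum_dyadic_powers_le r n : 0 <= r < 1 ->
  \sum_(s < n) (2 ^ s)%N%:R * r ^+ (2 ^ s) <= 2 * (1 - r)^-1.
Proof.
move=> rr; have /andP[r0 r1] := rr.
apply: (@le_trans _ _ (2 * \sum_(k < (2 ^ n).+1) r ^+ k)); last first.
  by rewrite ler_pM2l// geometric_sum_le.
have r_ge0 k : 0 <= r ^+ k by exact: exprn_ge0.
case: n => [|n]; first by rewrite big_ord0 mulr_ge0// sumr_ge0.
apply: (@le_trans _ _ (2 * \sum_(k < (2 ^ n).+1) r ^+ k)); last first.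
  by rewrite ler_pM2l//; apply: sum_ord_le => //; rewrite ltnS leq_exp2l.
elim: n => [|n IH].
  rewrite big_ord1 !big_ord_recl big_ord0 /= expr0 expr1.
  by rewrite /bump /=; have := r0; lra.
rewrite big_ord_recr /= (_ : (2 ^ n.+1).+1 = (2 ^ n).+1 + 2 ^ n)%N; last first.
  by rewrite expnS; lia.
rewrite big_split_ord /= mulrDr lerD// expnS natrM -mulrA ler_pM2l//.
rewrite mulr_natl -[X in _ *+ X]card_ord -sumr_const; apply: ler_sum => i _.
by apply: ler_wiXn2l; [exact: r0|exact: ltW|have := ltn_ord i; lia].
Qed.

Definition diag_ones (k : nat) : imatrix R := fun j m => (m == (j + k)%N)%:R.

Lemma form_bound_matching (M : imatrix R) (f : nat -> nat) c : 0 <= c ->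
    injective f -> (forall j m, nc (M j m) <= (m == f j)%:R * c) ->
  form_bound M c.
Proof.
move=> c0 f_inj Mc; apply: form_bound_schur => n i.
  apply: (@le_trans _ _ (\sum_(m < n) (m == f i :> nat)%:R * c)).
    by apply: ler_sum => m _; exact: Mc.
  rewrite -mulr_suml ler_piMl//.
  rewrite -natr_sum (ler_nat _ _ 1).
  elim: n => [|n IH]; first by rewrite big_ord0.
  rewrite big_ord_recr /=; have [->|_] := eqVneq n (f i); last by rewrite addn0.
  by rewrite big1// => m _; rewrite ltn_eqF.
apply: (@le_trans _ _ (\sum_(j < n) (i == f j :> nat)%:R * c)).
  by apply: ler_sum => j _; exact: Mc.
rewrite -mulr_suml ler_piMl//.
rewrite -natr_sum (ler_nat _ _ 1).
elim: n => [|n IH]; first by rewrite big_ord0.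
rewrite big_ord_recr /=; have [->|_] := eqVneq i (f n); last by rewrite addn0.
by rewrite big1// => j _; rewrite (inj_eq f_inj) gtn_eqF.
Qed.

(** Applied to translations, which give the diagonals of ones, and to the doubling map.
    Differentiation multiplies an entry by k r^(k-1) <= 1 / (1 - r), and Schur's test is immediate
    for a matching. *)
Lemma matching_bloch_test (f : nat -> nat) : injective f ->
  (forall j, (j <= f j)%N) -> bloch_test (fun j m => (m == f j)%:R : R[i]) 1.
Proof.
move=> f_inj fj; have ncb (b : bool) : nc b%:R = b%:R.
  by case: b; rewrite ?Normc.normc0 ?Normc.normc1.
split=> [j m mj||r rr].
- by rewrite ltn_eqF// (leq_trans mj).
- apply: form_bound_matching f_inj _ => // j m; rewrite mulr1 /diag.
  by case: ifP => _; rewrite ?ncb// Normc.normc0.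
- have /andP[r0 r1] := rr; rewrite div1r.
  apply: form_bound_matching f_inj _ => [|j m]; first by rewrite invr_ge0 subr_ge0 ltW.
  rewrite bloch_derivE; case: ifP => _; last first.
    by rewrite Normc.normc0 mulr_ge0// invr_ge0 subr_ge0 ltW.
  rewrite ncM ncb nc_real mulrC ler_wpM2l// ger0_norm; last first.
    by rewrite mulr_ge0// exprn_ge0.
  exact: natX_le_geometric.
Qed.

Lemma diag_ones_test k : bloch_test (diag_ones k) 1.
Proof.
by apply: (@matching_bloch_test (addn^~ k)); [exact: addIn|exact: leq_addr].
Qed.

Lemma diag_S1norm_ge0 A k : (0 <= diag_S1norm A k)%E.
Proof. by apply: nneseries_ge0 => l _ _; rewrite lee_fin nc_ge0. Qed.

Lemma diag_S1norm_le A k : (diag_S1norm A k <= abs_pairing A (diag_ones k))%E.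
Proof.
apply: le_trans (@diag_pairing_le _ A (diag_ones k) k.+1 (fun i => (i == k)%:R) _ _).
- rewrite big_ord_recr /= eqxx mul1e leeDr// sume_ge0// => i _.
  by rewrite mule_ge0 ?lee_fin ?diag_S1norm_ge0.
- by move=> i.
- move=> l i _; rewrite /diag_ones eqn_add2l.
  by case: (i == k); rewrite ?Normc.normc1 ?Normc.normc0.
Qed.

Lemma large_block s al : (forall k, 0 <= al k) ->
  exists g : nat -> R[i],
    (forall r, 0 <= r < 1 -> form_bound (bloch_deriv (block_mx s g) r)
        (90 * ((2 ^ s)%N%:R * r ^+ (2 ^ s)))) /\
    9 * Num.sqrt (\sum_(2 ^ s.+2 <= k < 2 ^ s.+3) al k ^+ 2)
      <= 16 * \sum_(2 ^ s.+2 <= k < 2 ^ s.+3) al k * nc (g k).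
Proof.
move=> al0; set q := (2 ^ s)%N; set N := (16 * q)%N.
have N0 : (0 < N)%N by rewrite muln_gt0 expn_gt0.
have [w w_prim] := @prim_root_exists R N N0.
(* Coefficients outside the block are set to 0, so that both sums over the N frequencies reduce to
   the block. *)
pose be k := if (2 ^ s.+2 <= k < 2 ^ s.+3)%N then al k else 0.
have be0 k : 0 <= be k by rewrite /be; case: ifP.
have [h h1 H] := large_fourier_coefs N0 w_prim be0.
exists (fourier_coef N w h); split=> [r rr|]; first exact: block_form_bound.
have trunc (F : nat -> R) (G : nat -> R) : (forall k, G k =
    if (2 ^ s.+2 <= k < 2 ^ s.+3)%N then F k else 0) ->
  \sum_(k < N) G k = \sum_(2 ^ s.+2 <= k < 2 ^ s.+3) F k.
  move=> GE; rewrite -(big_mkord xpredT G) (@big_cat_nat _ _ _ (2 ^ s.+3))//=; last first.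
    by rewrite /N /q !expnS; lia.
  rewrite (@big_cat_nat _ _ _ (2 ^ s.+2) 0)//= ?leq_exp2l//.
  rewrite [X in X + _ + _]big_nat big1 ?add0r => [|k /andP[_ kl]]; last first.
    by rewrite GE leqNgt kl.
  rewrite [X in _ + X]big_nat [X in _ + X]big1 ?addr0 => [|k /andP[kl _]]; last first.
    by rewrite GE [(k < _)%N]ltnNge kl andbF.
  by rewrite big_nat [RHS]big_nat; apply: eq_bigr => k kl; rewrite GE kl.
move: H; rewrite (trunc (fun k => al k ^+ 2) (fun k => be k ^+ 2)) => [|k]; last first.
  by rewrite /be; case: ifP => // _; rewrite expr0n.
rewrite (trunc (fun k => al k * nc (fourier_coef N w h k))
  (fun k => be k * nc (fourier_coef N w h k)))// => k.
by rewrite /be; case: ifP => // _; rewrite mul0r.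
Qed.

(* Only blocks of the same parity are used, so that the bands of
   [block_mx_band] do not overlap. *)
Lemma large_diagonals_test al (e : bool) : (forall k, 0 <= al k) ->
  exists B (ga : nat -> R), [/\ bloch_test B 180,
    forall k, 0 <= ga k,
    forall l k, ga k <= nc (B l (l + k)%N) &
    forall s, odd s = e ->
      9 * Num.sqrt (\sum_(2 ^ s.+2 <= k < 2 ^ s.+3) al k ^+ 2)
        <= 16 * \sum_(2 ^ s.+2 <= k < 2 ^ s.+3) al k * ga k].
Proof.
move=> al0; have [G HG] := choice (fun s => large_block s al0).
(* At column m only scales with 3 * 2^s < m contribute, so stopping at s = m loses nothing. *)
pose B : imatrix R := fun j m => \sum_(s < m.+1 | odd s == e) block_mx s (G s) j m.
have large s j m : (m <= s)%N -> block_mx s (G s) j m = 0.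
  move=> ms; apply/eqP; apply: contraT => /block_mx_band.
  by have := ltn_expl s (ltnSn 1); lia.
have BE n j m : (m <= n)%N -> B j m = \sum_(s < n | odd s == e) block_mx s (G s) j m.
  move=> mn; rewrite /B big_mkcond big_ord_recr /= large// if_same addr0.
  rewrite -(sum_trunc (fun s => if odd s == e then block_mx s (G s) j m else 0) mn).
  rewrite [RHS]big_mkcond; apply: eq_bigr => s _.
  by case: ifP => //; case: leqP => // /large ->; rewrite if_same.
have Bdiag l k s : odd s = e -> (2 ^ s.+2 <= k < 2 ^ s.+3)%N ->
    B l (l + k)%N = G s k.
  move=> se kl; have s4 : (2 ^ s.+2 = 4 * 2 ^ s)%N by rewrite !expnS mulnA.
  have s8 : (2 ^ s.+3 = 8 * 2 ^ s)%N by rewrite !expnS !mulnA.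
  have sk : (s < (l + k).+1)%N by have := ltn_expl s (ltnSn 1); lia.
  rewrite /B (bigD1 (Ordinal sk)) ?se//= block_mx_in_band -?s4 -?s8//.
  rewrite big1 ?addr0// => i /andP[/eqP ie]; rewrite -val_eqE /= => is_.
  apply/eqP; apply: contraT => /block_mx_band; rewrite !ltn_add2l.
  (* Equal parity separates distinct scales by at least 2: if i <= s - 2 then 9 * 2^i < 4 * 2^s, and
     if i >= s + 2 then 3 * 2^i > 8 * 2^s. Either way block i misses the offset k. *)
  have [lt|gt|E] := ltngtP (i : nat) s; last by rewrite E eqxx in is_.
    have i2 : (i.+2 <= s)%N.
      rewrite ltn_neqAle lt andbT; apply/eqP => E.
      by move: se; rewrite -E /= ie; case: (e).
    have := leq_pexp2l (isT : 0 < 2)%N i2; rewrite !expnS; lia.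
  have i2 : (s.+2 <= i)%N.
    rewrite ltn_neqAle gt andbT; apply/eqP => E.
    by move: ie; rewrite -E /= se; case: (e).
  have := leq_pexp2l (isT : 0 < 2)%N i2; rewrite !expnS; lia.
(* The scale is recovered from k by the logarithm; for k < 4, where [.-2] truncates, the band test
   fails and [ga k] is 0. *)
pose ga k := let s := (trunc_log 2 k).-2 in
  if (odd s == e) && (2 ^ s.+2 <= k < 2 ^ s.+3)%N then nc (G s k) else 0.
exists B, ga; split.
- split=> [j m mj||r rr].
  + rewrite /B big1// => s _; apply/eqP; apply: contraT => /block_mx_band; lia.
  + move=> n x y; rewrite big1 => [|j _].
      by rewrite Normc.normc0 mulr0 mulr_ge0// addr_ge0// sum_nc_sqr_ge0.
    rewrite big1// => m _; rewrite /diag; case: eqP => [->|_]; last by rewrite mulr0 mul0r.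
    rewrite /B big1 ?mulr0 ?mul0r// => s _.
    by apply/eqP; apply: contraT => /block_mx_band; lia.
  (* A section of size n meets only scales s < n, whose bounds 90 * 2^s r^(2^s) sum to at most 180 /
     (1 - r). *)
  + move=> n x y.
    have fb := form_bound_sum (index_enum 'I_n)
      (fun (s : 'I_n) (_ : odd s == e) => (HG s).1 r rr).
    have fc := @form_bound_le _ _ _ (180 / (1 - r)) (fb).
    have le : \sum_(s < n | odd s == e) 90 * ((2 ^ s)%N%:R * r ^+ (2 ^ s)) <= 180 / (1 - r).
      apply: (@le_trans _ _ (90 * \sum_(s < n) (2 ^ s)%N%:R * r ^+ (2 ^ s))).
        rewrite mulr_sumr big_mkcond; apply: ler_sum => s _; case: ifP => // _.
        by have /andP[r0 _] := rr; rewrite !mulr_ge0// exprn_ge0.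
      have := sum_dyadic_powers_le n rr; lra.
    apply: le_trans (fc le n x y); rewrite le_eqVlt; apply/orP; left; apply/eqP.
    congr (2 * nc _); apply: eq_bigr => j _; apply: eq_bigr => m _.
    congr (_ * _ * _); rewrite bloch_derivE.
    case: ifP => jm; last first.
      by rewrite big1// => s _; rewrite bloch_derivE jm.
    rewrite (BE n) ?mulr_sumr; last exact: ltnW.
    by apply: eq_bigr => s _; rewrite bloch_derivE jm.
- by move=> k; rewrite /ga; case: ifP => // _; exact: nc_ge0.
- move=> l k; rewrite /ga; case: ifP => [/andP[/eqP se kl]|_]; last exact: nc_ge0.
  by rewrite (Bdiag l k _ se kl).
- move=> s se; apply: le_trans (HG s).2 _; rewrite ler_pM2l//.
  rewrite le_eqVlt; apply/orP; left; apply/eqP.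
  rewrite big_nat [RHS]big_nat; apply: eq_bigr => k kl.
  by rewrite /ga (@trunc_log_eq 2 s.+2)//= se eqxx kl.
Qed.

Lemma sqrt_sum_sqr_le al m n : (forall k, 0 <= al k) ->
  Num.sqrt (\sum_(m <= k < n) al k ^+ 2) <= \sum_(m <= k < n) al k.
Proof.
move=> al0; have s0 : 0 <= \sum_(m <= k < n) al k by apply: sumr_ge0.
rewrite -[leRHS]ger0_norm// -sqrtr_sqr ler_wsqrtr//.
elim: n {s0} => [|n IH]; first by rewrite !big_geq// expr0n.
have [mn|nm] := leqP m n; last by rewrite !big_geq// expr0n.
rewrite !big_nat_recr//= sqrrD lerD2r (le_trans IH)// lerDl.
by rewrite mulrn_wge0// mulr_ge0// sumr_ge0.
Qed.

(** Blocks 0 and 1, that is k < 4, are controlled by single diagonals, an l_2 norm being at most the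
    l_1 norm; block s + 2 is controlled by the test matrix for the parity of s, with 2 >= 16/9. *)
Lemma MS1norm_le_pairings A : (forall k, (diag_S1norm A k < +oo)%E) ->
  exists2 B : bool -> imatrix R, forall e, bloch_test (B e) 180 &
    (MS1norm A <= \sum_(k < 4) abs_pairing A (diag_ones k)
        + 2%:E * (abs_pairing A (B false) + abs_pairing A (B true)))%E.
Proof.
move=> fin; pose al k := fine (diag_S1norm A k).
have alE k : (al k)%:E = diag_S1norm A k.
  by rewrite fineK// ge0_fin_numE ?diag_S1norm_ge0.
have al0 k : 0 <= al k by rewrite fine_ge0 ?diag_S1norm_ge0.
have [B /choice[ga H]] := choice (fun e => large_diagonals_test e al0).
exists B => [e|]; first by case: (H e).
have parity e L : ((\sum_(s < L | odd s == e)
    Num.sqrt (\sum_(2 ^ s.+2 <= k < 2 ^ s.+3) al k ^+ 2))%:E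
      <= 2%:E * abs_pairing A (B e))%E.
  have [_ ga0 gaB gaS] := H e.
  apply: (@le_trans _ _ (2%:E * (\sum_(k < 2 ^ L.+2) (ga e k)%:E * diag_S1norm A k))%E); last first.
    by rewrite lee_wpmul2l// diag_pairing_le// => l k _; exact: gaB.
  under [X in (_ <= _ * X)%E]eq_bigr => k _ do rewrite -alE -EFinM.
  rewrite sumEFin -EFinM lee_fin.
  have gaal k : 0 <= ga e k * al k by rewrite mulr_ge0.
  apply: (@le_trans _ _ (2 * \sum_(s < L) \sum_(2 ^ s.+2 <= k < 2 ^ s.+3) ga e k * al k)).
    rewrite mulr_sumr big_mkcond; apply: ler_sum => s _.
    have g0 : 0 <= \sum_(2 ^ s.+2 <= k < 2 ^ s.+3) ga e k * al k by apply: sumr_ge0.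
    case: ifP => [/eqP/gaS|_]; last by rewrite mulr_ge0.
    under [X in _ <= 16 * X -> _]eq_bigr => k _ do rewrite mulrC.
    by lra.
  rewrite ler_pM2l// -(big_mkord xpredT (fun k => ga e k * al k)) sum_blocks.
  rewrite big_nat_recl// big_nat_recl// addrA -(big_mkord xpredT
    (fun s => \sum_(2 ^ s.+2 <= k < 2 ^ s.+3) ga e k * al k)).
  by rewrite lerDr addr_ge0// sumr_ge0.
apply: nneseries_le_bound => [n|n]; first exact: sqrte_ge0.
(* Two more blocks are added so that the first two can always be split off. *)
apply: (@le_trans _ _ (\sum_(0 <= i < n.+2) sqrte
  (\sum_(block_start i <= k < 2 ^ i.+1) diag_S1norm A k ^+ 2))%E).
  rewrite [leRHS](@big_cat_nat _ _ _ n)//=; last by rewrite ltnW.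
  apply: leeDl; apply: sume_ge0 => i _; exact: sqrte_ge0.
have sE i : sqrte (\sum_(block_start i <= k < 2 ^ i.+1) diag_S1norm A k ^+ 2)%E
    = (Num.sqrt (\sum_(block_start i <= k < 2 ^ i.+1) al k ^+ 2))%:E.
  rewrite -[RHS]/(sqrte (\sum_(block_start i <= k < 2 ^ i.+1) al k ^+ 2)%:E).
  by rewrite -sumEFin; congr sqrte; apply: eq_bigr => k _; rewrite -alE EFin_expe.
under eq_bigr => i _ do rewrite sE.
rewrite big_nat_recl// big_nat_recl// addeA; apply: leeD.
  apply: (@le_trans _ _ (\sum_(k < 4) (al k)%:E)%E); last first.
    by apply: lee_sum => k _; rewrite alE diag_S1norm_le.
  rewrite sumEFin -EFinD lee_fin -(big_mkord xpredT al).
  rewrite [leRHS](@big_cat_nat _ _ _ 2)//= lerD//; exact: sqrt_sum_sqr_le.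
rewrite sumEFin (bigID (fun s => odd s == false)) /= EFinD muleDr; last 2 first.
- by [].
- by rewrite ge0_adde_def// inE esum_ge0// => p _; rewrite lee_fin nc_ge0.
rewrite !big_mkord; apply: leeD; first exact: parity.
rewrite (eq_bigl (fun s : 'I_n => odd s == true)); first exact: parity.
by move=> s; case: (odd s).
Qed.

End TestMatrices.

(** * The inclusions *)

Section Inclusions.
Local Open Scope ring_scope.
Local Open Scope complex_scope.
Variable R : realType.
Implicit Types (A B : imatrix R).
Notation nc := (@Normc.normc R).

Lemma bloch_bounded B : bloch R B ->
  exists2 M : R, 0 < M & (blochnorm B <= M%:E)%E.
Proof.
move=> [_]; case: (blochnorm B) => [b _|//|_].
  exists (`|b| + 1); first by rewrite ltr_wpDl.
  by rewrite lee_fin (le_trans (ler_norm b))// lerDl.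
by exists 1 => //; rewrite leNye.
Qed.

Lemma R21_bloch_kothe A : R21 R A -> bloch_kothe R A.
Proof.
move=> [Au Afin]; split=> // B /bloch_bounded[M M0 BM].
apply: le_lt_trans (row_pairing_le M0 Au BM) _.
by rewrite lte_mul_pinfty ?lee_fin// mulr_ge0// ltW.
Qed.

Lemma C21_bloch_kothe A : C21 R A -> bloch_kothe R A.
Proof.
move=> [Au Afin]; split=> // B /bloch_bounded[M M0 BM].
apply: le_lt_trans (col_pairing_le M0 Au BM) _.
by rewrite lte_mul_pinfty ?lee_fin// mulr_ge0// ltW.
Qed.

Lemma abs_pairing_add_le A1 A2 B :
  (abs_pairing (add_imatrix A1 A2) B <= abs_pairing A1 B + abs_pairing A2 B)%E.
Proof.
apply: abs_pairing_le => N.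
apply: (@le_trans _ _ (partial_pairing A1 B N + partial_pairing A2 B N)%:E).
  by rewrite lee_fin partial_pairing_add.
by rewrite EFinD; apply: leeD; exact: partial_pairing_le.
Qed.

Lemma R21_plus_C21_bloch_kothe : R21_plus_C21 R `<=` bloch_kothe R.
Proof.
move=> _ [A1 A1R [A2 A2C <-]].
have [A1u A1B] := R21_bloch_kothe A1R; have [A2u A2B] := C21_bloch_kothe A2C.
split=> [j m mj|B BB]; first by rewrite /add_imatrix A1u// A2u// addr0.
apply: le_lt_trans (abs_pairing_add_le A1 A2 B) _.
by apply: lte_add_pinfty; [exact: A1B|exact: A2B].
Qed.

Lemma kothenorm_add_le A1 A2 : R21 R A1 -> C21 R A2 ->
  (kothenorm (add_imatrix A1 A2) <= 9%:E * (rownorm A1 + colnorm A2))%E.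
Proof.
move=> [A1u _] [A2u _]; apply: ge_ereal_sup => _ [B [_ B1] <-].
apply: le_trans (abs_pairing_add_le A1 A2 B) _.
have e0 (u : nat -> R[i]) : (0 <= ell21 (@cabs R \o u))%E.
  by apply: nneseries_ge0 => n _ _; exact: sqrte_ge0.
rewrite muleDr//; last first.
  by rewrite ge0_adde_def// inE nneseries_ge0.
apply: leeD; first by have := row_pairing_le ltr01 A1u B1; rewrite mulr1.
by have := col_pairing_le ltr01 A2u B1; rewrite mulr1.
Qed.

Lemma bloch_kothe_diag_fin A k : bloch_kothe R A -> (diag_S1norm A k < +oo)%E.
Proof.
move=> [_ AB]; apply: le_lt_trans (diag_S1norm_le A k) _; apply: AB.
exact: bloch_test_bloch (diag_ones_test R k).
Qed.

Lemma bloch_kothe_MS1_21 : bloch_kothe R `<=` MS1_21 R.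
Proof.
move=> A AK; have [Au AB] := AK; split=> //.
have [B Bt le] := MS1norm_le_pairings (fun k => bloch_kothe_diag_fin k AK).
apply: le_lt_trans le _.
have Bfin e : (abs_pairing A (B e) < +oo)%E by apply/AB/(bloch_test_bloch _ (Bt e)).
rewrite lte_add_pinfty//; last first.
  by rewrite lte_mul_pinfty ?lee_fin// lte_add_pinfty.
apply: lte_sum_pinfty => k _; apply: AB.
exact: bloch_test_bloch (diag_ones_test R k).
Qed.

Lemma kothenorm_ge0 A : (0 <= kothenorm A)%E.
Proof.
have := test_pairing_le_kothenorm A ltr01 (diag_ones_test R 0).
have : (0 <= abs_pairing A (diag_ones R 0))%E.
  by apply: esum_ge0 => p _; rewrite lee_fin nc_ge0.
move=> h /(le_trans h); rewrite pmule_rge0// lte_fin; lra.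
Qed.

Lemma MS1norm_le_kothenorm : exists2 c : R, 0 < c &
  forall A, bloch_kothe R A -> (MS1norm A <= c%:E * kothenorm A)%E.
Proof.
have [T [T0 Tle]] : exists T : R, 0 < T /\ forall A B, bloch_test B 180 ->
    (abs_pairing A B <= T%:E * kothenorm A)%E.
  exists (3 * 180); split=> [|A B]; first by rewrite mulr_gt0.
  exact: test_pairing_le_kothenorm.
(* Four diagonals of ones with test constant 1, and two test matrices with constant 180 entering
   with the factor 2. *)
exists (3 * 1 *+ 4 + 2 * (T + T)) => [|A AK]; first by move: T0; lra.
have [B Bt le] := MS1norm_le_pairings (fun k => bloch_kothe_diag_fin k AK).
apply: le_trans le _; have K0 := kothenorm_ge0 A.
have T2 : 0 <= T + T by rewrite addr_ge0// ltW.
have T22 : 0 <= 2 * (T + T) by rewrite mulr_ge0.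
have P0 : (0 : R) <= 3 * 1 *+ 4 by rewrite mulrn_wge0// mulr1.
rewrite [X in (_ <= X * _)%E]EFinD [leRHS]ge0_muleDl ?lee_fin//; apply: leeD.
  apply: (@le_trans _ _ (\sum_(k < 4) (3 * 1)%:E * kothenorm A)%E).
    by apply: lee_sum => k _; exact: test_pairing_le_kothenorm (diag_ones_test R k).
  rewrite -ge0_sume_distrl => [|k _]; last by rewrite lee_fin mulr1.
  by rewrite sumEFin sumr_const card_ord.
rewrite EFinM -muleA; apply: lee_wpmul2l => //.
rewrite EFinD [leRHS]ge0_muleDl ?lee_fin ?(ltW T0)//.
by apply: leeD; exact: Tle.
Qed.

End Inclusions.

(** * Counterexamples *)

Section Counterexamples.
Local Open Scope ring_scope.
Local Open Scope complex_scope.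
Variable R : realType.
Implicit Types (A B : imatrix R).
Notation nc := (@Normc.normc R).

Lemma sum_indicator_le n a : \sum_(m < n) (m == a :> nat)%:R <= 1 :> R.
Proof.
elim: n => [|n IH]; first by rewrite big_ord0.
rewrite big_ord_recr /=; have [->|_] := eqVneq n a; last by rewrite addr0.
by rewrite big1 ?add0r// => m _; rewrite ltn_eqF.
Qed.

(** Pair with the k-th unit sequence, whose block norms are at most 1. *)
Lemma ell21_ge (a : nat -> R[i]) k : ((nc (a k))%:E <= ell21 (@cabs R \o a))%E.
Proof.
pose b i : R[i] := (i == k)%:R.
have nb i : nc (b i) = (i == k)%:R.
  by rewrite /b; case: (i == k); rewrite ?Normc.normc1 ?Normc.normc0.
rewrite -[leRHS]mul1e.
apply: le_trans (@ell21_pairing _ a b 1 k.+1 ltr01 _) => [|n].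
  rewrite lee_fin big_ord_recr /= nb eqxx mulr1 lerDr sumr_ge0// => i _.
  by rewrite mulr_ge0 ?nc_ge0.
rewrite expr1n; apply: le_trans (sum_indicator_le (2 ^ n.+1) k).
rewrite -(big_mkord xpredT (fun m => (m == k)%:R)).
rewrite [leRHS](@big_cat_nat _ _ _ (block_start n))//=; last exact: block_start_le.
rewrite ler_wpDl ?sumr_ge0//; apply: ler_sum => i _.
by rewrite nb; case: (i == k); rewrite ?expr1n ?expr0n.
Qed.

Lemma ell21_ge0 (a : nat -> R[i]) : (0 <= ell21 (@cabs R \o a))%E.
Proof. by apply: nneseries_ge0 => n _ _; exact: sqrte_ge0. Qed.

(** Only one block contributes, with at most 2^n nonzero entries; for n = 0 the support condition
    leaves k = 1 alone, in agreement with this count. *)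
Lemma ell21_block_le (a : nat -> R[i]) n (v : R) : 0 <= v ->
    (forall k, a k != 0 -> (2 ^ n <= k < 2 ^ n.+1)%N) ->
    (forall k, nc (a k) <= v) ->
  (ell21 (@cabs R \o a) <= (Num.sqrt (2 ^+ n) * v)%:E)%E.
Proof.
move=> v0 a_supp av.
have blk i : sqrte (\sum_(block_start i <= k < 2 ^ i.+1) cabs (a k) ^+ 2)%E
    = (Num.sqrt (\sum_(block_start i <= k < 2 ^ i.+1) nc (a k) ^+ 2))%:E.
  rewrite -[RHS]/(sqrte (\sum_(block_start i <= k < 2 ^ i.+1) nc (a k) ^+ 2)%:E).
  by rewrite -sumEFin; congr sqrte; apply: eq_bigr => k _; rewrite EFin_expe.
have off k : ~~ (2 ^ n <= k < 2 ^ n.+1)%N -> nc (a k) ^+ 2 = 0.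
  move=> kn; have [->|/a_supp] := eqVneq (a k) 0; last by rewrite (negbTE kn).
  by rewrite Normc.normc0 expr0n.
apply: nneseries_le_bound => [i|N]; first exact: sqrte_ge0.
under eq_bigr => i _ do rewrite blk.
rewrite sumEFin lee_fin big_mkord.
apply: (@le_trans _ _ (\sum_(i < N) (i == n :> nat)%:R * (Num.sqrt (2 ^+ n) * v))); last first.
  by rewrite -mulr_suml ler_piMl ?sum_indicator_le// mulr_ge0// sqrtr_ge0.
apply: ler_sum => i _; have [->|ni] := eqVneq (i : nat) n; last first.
  rewrite mul0r big_nat big1 ?sqrtr0// => k /andP[ik ki]; apply: off.
  apply/negP => /andP[nk kn]; move: ni; apply/negP; rewrite negbK eqn_leq.
  have -> : (i <= n)%N.
    rewrite leqNgt; apply/negP => lt; move: ik kn lt.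
    case: (i : nat) => // i' /= ik kn lt.
    by have := leq_pexp2l (isT : 0 < 2)%N lt; lia.
  rewrite leqNgt; apply/negP => lt.
  by have := leq_pexp2l (isT : 0 < 2)%N lt; lia.
rewrite mul1r -[v]ger0_norm// -sqrtr_sqr -sqrtrM ?exprn_ge0// ler_wsqrtr//.
apply: (@le_trans _ _ (\sum_(2 ^ n <= k < 2 ^ n.+1) v ^+ 2)).
  have nn : (block_start n <= 2 ^ n)%N by case: n {a_supp off}.
  rewrite (@big_cat_nat _ _ _ (2 ^ n))//= ?leq_exp2l//.
  rewrite big_nat big1 ?add0r => [|k /andP[_ kn]]; last first.
    by apply: off; rewrite leqNgt kn.
  by apply: ler_sum => k _; rewrite lerXn2r ?nnegrE ?nc_ge0.
rewrite sumr_const_nat expnS mul2n -addnn addnK -[leLHS]mulr_natl natrX.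
by [].
Qed.

Lemma sum_halves_le n : \sum_(i < n) 2^-1 ^+ i <= 2 :> R.
Proof.
have h : 0 <= (2^-1 : R) < 1 by apply/andP; split; lra.
have := geometric_sum_le n h.
by rewrite (_ : 1 - 2^-1 = 2^-1) ?invrK//; lra.
Qed.

Lemma sqrt_block_weight i : Num.sqrt (2 ^+ (4 * i)) * 8^-1 ^+ i = 2^-1 ^+ i :> R.
Proof.
rewrite (_ : 2 ^+ (4 * i) = (4 ^+ i) ^+ 2 :> R).
  by rewrite sqrtr_sqr ger0_norm ?exprn_ge0// -exprMn; congr (_ ^+ i); lra.
rewrite -exprM [(i * 2)%N]mulnC !exprM; congr (_ ^+ i); ring.
Qed.

Lemma pow2_unbounded (x : \bar R) : (forall i, ((2 ^+ i)%:E <= x)%E) -> x = +oo%E.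
Proof.
case: x => [r||] // h; last by have := h 0%N.
have := h (Num.Def.archi_bound r); rewrite lee_fin leNgt.
by rewrite (@upper_nthrootP _ r _ (leqnn _)).
Qed.

(** The norm of each column dominates its entry in row i, so a row of large l_1 norm makes [colnorm]
    large. *)
Lemma colnorm_ge A i n : upper_triangular A ->
  ((\sum_(m < n) nc (A i m))%:E <= colnorm A)%E.
Proof.
move=> Au; apply: (@le_trans _ _ (\sum_(0 <= m < n) ell21 (@cabs R \o colseq A m))%E).
  rewrite big_mkord -sumEFin; apply: lee_sum => m _.
  have [im|mi] := leqP i m; last by rewrite Au// Normc.normc0 ell21_ge0.
  apply: le_trans (ell21_ge (colseq A m) (m - i)%N).
  by rewrite /colseq leq_subr subKn.
by apply: nneseries_lim_ge => m _ _; exact: ell21_ge0.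
Qed.

Lemma rownorm_ge A m n : upper_triangular A ->
  ((\sum_(j < n) nc (A j m))%:E <= rownorm A)%E.
Proof.
move=> Au; apply: (@le_trans _ _ (\sum_(0 <= j < n) ell21 (@cabs R \o rowseq A j))%E).
  rewrite big_mkord -sumEFin; apply: lee_sum => j _.
  have [jm|mj] := leqP j m; last by rewrite Au// Normc.normc0 ell21_ge0.
  apply: le_trans (ell21_ge (rowseq A j) (m - j)%N).
  by rewrite /rowseq subnKC.
by apply: nneseries_lim_ge => j _ _; exact: ell21_ge0.
Qed.

Lemma pow2_block_weight i : (2 ^ (4 * i))%N%:R * 8^-1 ^+ i = 2 ^+ i :> R.
Proof. by rewrite natrX exprM -exprMn; congr (_ ^+ i); lra. Qed.

Lemma nc_real_ge0 (a : R) : 0 <= a -> nc a%:C = a.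
Proof. by move=> a0; rewrite nc_real ger0_norm. Qed.

(** Row j has 16^j entries 8^-j in one block: its l_2 norm 4^j 8^-j = 2^-j is summable, while its
    l_1 norm 2^j is unbounded. *)
Definition dyadic_rows : imatrix R := fun j m =>
  if (j + 2 ^ (4 * j) <= m < j + 2 ^ (4 * j).+1)%N then (8^-1 ^+ j)%:C else 0.

(** The same weights in column 2^(4 i + 1), tall enough to contain the block; the logarithm recovers
    i because 16^i <= 2 * 16^i < 16^(i+1). *)
Definition dyadic_cols : imatrix R := fun j m =>
  let i := trunc_log 16 m in
  if (m == 2 ^ (4 * i).+1)%N && (2 ^ (4 * i) <= m - j < 2 ^ (4 * i).+1)%N
  then (8^-1 ^+ i)%:C else 0.

(** The corner entry is the inverse of 0, that is 0; diagonal k carries the single entry 1 / k. *)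
Definition harmonic_mx : imatrix R := fun j m =>
  if (m == j + j)%N then (j%:R^-1)%:C else 0.

Lemma dyadic_rows_ut : upper_triangular dyadic_rows.
Proof. by move=> j m mj; rewrite /dyadic_rows ifF//; apply/negbTE; lia. Qed.

Lemma dyadic_rows_R21 : R21 R dyadic_rows.
Proof.
split; first exact: dyadic_rows_ut.
apply: (@le_lt_trans _ _ 2%:E); last exact: ltry.
apply: nneseries_le_bound => [j|n]; first exact: ell21_ge0.
apply: (@le_trans _ _ (\sum_(j < n) 2^-1 ^+ j)%:E); last by rewrite lee_fin sum_halves_le.
rewrite big_mkord -sumEFin; apply: lee_sum => j _.
rewrite -sqrt_block_weight; apply: ell21_block_le => // k.
  rewrite /rowseq /dyadic_rows !leq_add2l ltn_add2l.
  by case: ifP => //; rewrite eqxx.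
rewrite /rowseq /dyadic_rows; case: ifP => _; last by rewrite Normc.normc0.
by rewrite nc_real_ge0.
Qed.

Lemma dyadic_rows_colnorm : colnorm dyadic_rows = +oo%E.
Proof.
apply: pow2_unbounded => i.
apply: le_trans (@colnorm_ge _ i (i + 2 ^ (4 * i).+1)%N dyadic_rows_ut).
rewrite lee_fin -pow2_block_weight.
apply: le_trans (@sum_ord_shift_le _ (fun m => nc (dyadic_rows i m))
  (i + 2 ^ (4 * i))%N (2 ^ (4 * i))%N _ _ _).
- rewrite mulr_natl -[X in _ *+ X]card_ord -sumr_const; apply: ler_sum => k _.
  rewrite /dyadic_rows ifT ?nc_real_ge0//.
  by have := ltn_ord k; rewrite expnS; lia.
- by move=> m; exact: nc_ge0.
- by rewrite expnS; lia.
Qed.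

Lemma dyadic_cols_ut : upper_triangular dyadic_cols.
Proof.
move=> j m mj; rewrite /dyadic_cols (_ : (m - j)%N = 0%N); last by lia.
by rewrite leqn0 expn_eq0 /= andbF.
Qed.

Lemma dyadic_cols_C21 : C21 R dyadic_cols.
Proof.
split; first exact: dyadic_cols_ut.
apply: (@le_lt_trans _ _ 2%:E); last exact: ltry.
apply: nneseries_le_bound => [j|n]; first exact: ell21_ge0.
have half0 i : (0 : R) <= 2^-1 ^+ i by rewrite exprn_ge0.
(* Each i belongs to a single column, so exchanging the sums over m and i leaves the geometric
   series of 2^-i. *)
pose c m : R := \sum_(i < n) (m == 2 ^ (4 * i).+1)%N%:R * 2^-1 ^+ i.
apply: (@le_trans _ _ (\sum_(m < n) c m)%:E); last first.
  rewrite lee_fin exchange_big /=; apply: le_trans (sum_halves_le n).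
  by apply: ler_sum => i _; rewrite -mulr_suml ler_piMl// sum_indicator_le.
rewrite big_mkord -sumEFin; apply: lee_sum => m _.
set i := trunc_log 16 m.
pose d : R := (m == 2 ^ (4 * i).+1 :> nat)%N%:R * 2^-1 ^+ i.
apply: (@le_trans _ _ d%:E).
  rewrite /d -sqrt_block_weight mulrCA; apply: ell21_block_le => [|k|k].
  - by rewrite mulr_ge0.
  - rewrite /colseq; have [km|km] := leqP k m; last by rewrite eqxx.
    rewrite /dyadic_cols subKn// -/i; case: ifP => [/andP[]//|].
    by rewrite eqxx.
  - rewrite /colseq; have [km|km] := leqP k m; last by rewrite Normc.normc0 mulr_ge0.
    rewrite /dyadic_cols subKn// -/i; case: ifP => [/andP[-> _]|_].
      by rewrite mul1r nc_real_ge0.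
    by rewrite Normc.normc0 mulr_ge0.
(* For m > 0, i < 16^i <= m < n, so the scale of column m occurs in [c m]. *)
have im : (i < n)%N.
  apply: leq_ltn_trans (ltn_ord m); have [m0|m0] := posnP m.
    by rewrite /i m0 trunc_log0.
  apply: leq_trans (trunc_logP (isT : 1 < 16)%N m0).
  by rewrite ltnW// ltn_expl.
by rewrite lee_fin /c (bigD1 (Ordinal im))//= lerDl sumr_ge0// => k _; rewrite mulr_ge0.
Qed.

Lemma dyadic_cols_rownorm : rownorm dyadic_cols = +oo%E.
Proof.
apply: pow2_unbounded => i; set K := (2 ^ (4 * i))%N.
have K0 : (0 < K)%N by rewrite expn_gt0.
have mE : (2 ^ (4 * i).+1 = 2 * K)%N by rewrite expnS.
have tl : trunc_log 16 (2 * K) = i.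
  have KE : K = (16 ^ i)%N by rewrite /K expnM.
  by apply: trunc_log_eq => //; rewrite expnS -KE; lia.
apply: le_trans (@rownorm_ge _ (2 * K)%N (2 * K)%N dyadic_cols_ut).
rewrite lee_fin -pow2_block_weight -/K.
(* In column 2 K the offsets K <= m - j < 2 K are the rows 1 <= j <= K, hence the shift by 1. *)
apply: le_trans (@sum_ord_shift_le _ (fun j => nc (dyadic_cols j (2 * K)%N))
  1%N K _ _ _).
- rewrite mulr_natl -[X in _ *+ X]card_ord -sumr_const; apply: ler_sum => k _.
  rewrite /dyadic_cols tl mE -/K ifT ?nc_real_ge0//.
  by have := ltn_ord k; lia.
- by move=> j; exact: nc_ge0.
- by lia.
Qed.

Lemma harmonic_mx_MS1_21 : MS1_21 R harmonic_mx.
Proof.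
have inv0 k : (0 : R) <= k%:R^-1 by rewrite invr_ge0.
split=> [j m mj|]; first by rewrite /harmonic_mx ifF//; apply/negbTE; lia.
have S1 k : (diag_S1norm harmonic_mx k <= (k%:R^-1)%:E)%E.
  apply: nneseries_le_bound => [l|n]; first by rewrite lee_fin nc_ge0.
  rewrite big_mkord sumEFin lee_fin.
  apply: (@le_trans _ _ (\sum_(l < n) (l == k :> nat)%:R * k%:R^-1)); last first.
    by rewrite -mulr_suml ler_piMl// sum_indicator_le.
  apply: ler_sum => l _; rewrite /harmonic_mx eqn_add2l eq_sym.
  have [->|_] := eqVneq (l : nat) k; first by rewrite mul1r nc_real_ge0.
  by rewrite Normc.normc0 mul0r.
(* On block n the sum of 1 / k^2 is at most 2^n 4^-n = 2^-n, so the block norms are dominated by the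
   powers of 2^(-1/2). *)
set x : R := Num.sqrt 2^-1.
have x2 : x ^+ 2 = 2^-1 by rewrite sqr_sqrtr.
have x0 : 0 <= x by exact: sqrtr_ge0.
have x1 : x < 1 by rewrite -(@ltr_pXn2r _ 2)// ?nnegrE// x2; lra.
apply: (@le_lt_trans _ _ ((1 - x)^-1)%:E); last exact: ltry.
apply: nneseries_le_bound => [n|N]; first exact: sqrte_ge0.
apply: (@le_trans _ _ (\sum_(n < N) x ^+ n)%:E); last first.
  by rewrite lee_fin geometric_sum_le// x0.
rewrite big_mkord -sumEFin; apply: lee_sum => n _.
apply: (@le_trans _ _ (sqrte (\sum_(block_start n <= k < 2 ^ n.+1) k%:R^-1 ^+ 2 : R)%:E)).
  rewrite lee_sqrt; last by rewrite lee_fin sumr_ge0// => k _; exact: sqr_ge0.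
  rewrite -sumEFin; apply: lee_sum => k _; rewrite EFin_expe.
  by apply: lee_pmul => //; exact: diag_S1norm_ge0.
rewrite lee_fin -[x ^+ n]ger0_norm ?exprn_ge0// -sqrtr_sqr ler_wsqrtr//.
rewrite -exprM mulnC exprM x2.
have main i : \sum_(2 ^ i <= k < 2 ^ i.+1) (k%:R^-1 ^+ 2 : R) <= 2^-1 ^+ i.
  apply: (@le_trans _ _ (\sum_(2 ^ i <= k < 2 ^ i.+1) (2^-1 ^+ i * 2^-1 ^+ i : R))).
    rewrite big_nat [leRHS]big_nat; apply: ler_sum => k /andP[ik _].
    have ki : k%:R^-1 <= 2^-1 ^+ i :> R.
      rewrite exprVn -natrX lef_pV2 ?posrE ?ltr0n ?expn_gt0// ?ler_nat//.
      by rewrite (leq_trans _ ik)// expn_gt0.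
    by rewrite expr2 ler_pM.
  rewrite sumr_const_nat expnS mul2n -addnn addnK -[leLHS]mulr_natl natrX mulrA.
  by rewrite -exprMn divff ?expr1n ?mul1r.
case: (n : nat) => [|n'] /=; last exact: main.
(* The zeroth block contains k = 0, whose inverse counts as 0. *)
rewrite big_nat_recr//= big_nat1 invr0 expr0n add0r.
by rewrite invr1 expr1n expr0.
Qed.

Lemma harmonic_mx_not_kothe : ~ bloch_kothe R harmonic_mx.
Proof.
have dbl_inj : injective (fun j => j + j)%N by move=> j m /= h; lia.
have Bt := @matching_bloch_test R _ dbl_inj (fun j => leq_addr j j).
set B : imatrix R := fun j m => _ in Bt.
move=> [_ /(_ _ (bloch_test_bloch ltr01 Bt))].
have : (0 <= abs_pairing harmonic_mx B)%E.
  by apply: esum_ge0 => p _; rewrite lee_fin nc_ge0.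
case E : (abs_pairing _ _) => [b||]// _ _.
(* A finite pairing would bound the partial sums of the harmonic series: row 0 contributes nothing
   and row k + 1 contributes 1 / (k + 1). *)
apply: (@dvg_harmonic R); rewrite seriesEord.
apply: (@is_cvg_abs_bounded _ (harmonic : nat -> R) b) => n.
have := partial_pairing_le harmonic_mx B (n.+1 + n.+1)%N; rewrite E lee_fin.
apply: le_trans.
have pp0 j m : 0 <= nc (harmonic_mx j m * B j m) by exact: nc_ge0.
apply: le_trans (@sum_ord_shift_le _ (fun j => \sum_(m < n.+1 + n.+1)
    nc (harmonic_mx j m * B j m)) 1%N n _ _ _).
- apply: ler_sum => k _.
  apply: le_trans (@sum_ord_shift_le _ (fun m => nc (harmonic_mx (1 + k)%N m *
    B (1 + k)%N m)) (1 + k + (1 + k))%N 1%N _ _ _) => //.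
  + rewrite big_ord1 addn0 (_ : harmonic_mx _ _ = ((1 + k)%N%:R^-1)%:C).
      rewrite /B eqxx mulr1 nc_real_ge0 ?invr_ge0// add1n.
      by rewrite /harmonic /= ger0_norm ?invr_ge0.
    by rewrite /harmonic_mx eqxx.
  + by have := ltn_ord k; lia.
- by move=> j; rewrite sumr_ge0.
- by lia.
Qed.

End Counterexamples.

Theorem theoremB (R : realType) :
  [/\ (* first inclusion, with its norm bound *)
      R21_plus_C21 R `<=` bloch_kothe R /\
      (exists2 c : R, (0 < c)%R & forall A1 A2 : imatrix R,
        R21 R A1 -> C21 R A2 ->
        kothenorm (add_imatrix A1 A2) <= c%:E * (rownorm A1 + colnorm A2)),
      (* second inclusion, strict, with its norm bound *)
      bloch_kothe R `<` MS1_21 R /\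
      (exists2 c : R, (0 < c)%R & forall A : imatrix R,
        bloch_kothe R A -> MS1norm A <= c%:E * kothenorm A),
      bloch_kothe R `\` R21 R !=set0 &
      bloch_kothe R `\` C21 R !=set0].
Proof.
split.
- split; first exact: R21_plus_C21_bloch_kothe.
  by exists 9%R => // A1 A2; exact: kothenorm_add_le.
- split; last exact: MS1norm_le_kothenorm.
  split; first exact: bloch_kothe_MS1_21.
  by move=> /(_ _ (harmonic_mx_MS1_21 R)); exact: harmonic_mx_not_kothe.
- exists (dyadic_cols R); split; first exact/C21_bloch_kothe/dyadic_cols_C21.
  by move=> [_]; rewrite dyadic_cols_rownorm.
- exists (dyadic_rows R); split; first exact/R21_bloch_kothe/dyadic_rows_R21.
  by move=> [_]; rewrite dyadic_rows_colnorm.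
Qed.
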